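(* Let $(\Omega,\mathcal{F},\mathbb{P})$ be a complete probability space, $t_0<T$, $x_0$ a random variable and $a$ a stochastic process on $[t_0,T]$, and let $x(t,\omega)=x_0(\omega)\mathrm{e}^{\int_{t_0}^t a(s,\omega)\mathrm{d} s}$. Assume: (H1) $a\in \mathrm{L}^2([t_0,T]\times\Omega)$; (H2) for every $N\ge1$, $x_0$ and $(\xi_1,\ldots,\xi_N)$ are absolutely continuous and independent; (H3) the density $f_0$ of $x_0$ is continuous on $D(x_0)$ and there is a constant $C$ with $f_0(x)\le C/|x|$ for all $0\ne x\in D(x_0)$. Then for all $x\ne0$ and $t\in[t_0,T]$, the sequence \[ f_1^N(x,t)=\int_{\mathbb{R}^N} f_0\big(x\,\mathrm{e}^{-K_a(t,\pmb{\xi}_N)}\big)f_{\pmb{\xi}_N}(\pmb{\xi}_N)\,\mathrm{e}^{-K_a(t,\pmb{\xi}_N)}\,\mathrm{d}\pmb{\xi}_N \] converges to $f_1(x,t)$, where $f_1(\cdot,t)$ is a probability density of $x(t,\cdot)$.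
   Context: Karhunen–Loève expansion: for $a\in \mathrm{L}^2([t_0,T]\times\Omega)$ write $a(t,\omega)=\mu_a(t)+\sum_{j=1}^\infty\sqrt{\nu_j}\,\phi_j(t)\xi_j(\omega)$ (convergence in $\mathrm{L}^2([t_0,T]\times\Omega)$), where $\mu_a(t)=\mathbb{E}[a(t)]$, $\{(\nu_j,\phi_j)\}$ are the (nonnegative) eigenvalue/eigenfunction pairs of the covariance operator $\mathcal{C}f(t)=\int_{t_0}^T\mathrm{Cov}[a(t),a(s)]f(s)\,\mathrm{d} s$ on $\mathrm{L}^2([t_0,T])$ with $\{\phi_j\}$ an orthonormal basis, and $\xi_j$ are zero-mean, unit-variance, pairwise uncorrelated random variables; pairs may be enumerated in any order, and if only finitely many eigenvalues are nonzero, vectors stop at that number. $\pmb{\xi}_N=(\xi_1,\ldots,\xi_N)$, $f_{\pmb{\xi}_N}$ its density, $K_a(t,\pmb{\xi}_N)=\int_{t_0}^t\big(\mu_a(s)+\sum_{j=1}^N\sqrt{\nu_j}\phi_j(s)\xi_j\big)\mathrm{d} s$. $D(x_0)=(0,\infty)$ if $x_0>0$ a.s., $D(x_0)=(-\infty,0)$ if $x_0<0$ a.s., and $D(x_0)=\mathbb{R}$ otherwise. *)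

(* Defs.v *)
From HB Require Import structures.
From mathcomp Require Import all_boot all_order all_algebra.
From mathcomp Require Import all_classical all_reals all_analysis.
Set Implicit Arguments.
Unset Strict Implicit.
Unset Printing Implicit Defensive.
Import Order.TTheory GRing.Theory Num.Theory.
Import numFieldNormedType.Exports.
Local Open Scope classical_set_scope.
Local Open Scope ring_scope.

(* Euclidean space R^n with its Lebesgue measure, built as the iterated *)
(* product  R^0 = unit (point mass),  R^(n+1) = R^n * R  with the       *)
(* product measure  leb_n \x leb.                                       *)
Record mspace (R : realType) := MSpace {
  ms_disp : measure_display;
  ms_type : measurableType ms_disp;
  ms_meas : {measure set ms_type -> \bar R} }.
Arguments MSpace {R ms_disp ms_type}.
Arguments ms_disp {R}. Arguments ms_type {R}. Arguments ms_meas {R}.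

Fixpoint Rspace (R : realType) (n : nat) : mspace R :=
  match n with
  | 0 => MSpace (@dirac _ unit tt R)
  | n.+1 => MSpace ((ms_meas (Rspace R n)) \x (@lebesgue_measure R))%E
  end.

(* j-th coordinate (0-based) of a point of R^n (0 if j >= n) *)
Fixpoint coord (R : realType) (n : nat) : ms_type (Rspace R n) -> nat -> R :=
  match n return ms_type (Rspace R n) -> nat -> R with
  | 0 => fun _ _ => 0
  | n.+1 => fun p j => if j == n then p.2 else coord p.1 j
  end.

(* the random vector  xi_N = (xi_0, ..., xi_(N-1))  (0-based indexing) *)
Fixpoint xivec (R : realType) d (O : measurableType d) (xi : nat -> O -> R)
    (n : nat) : O -> ms_type (Rspace R n) :=
  match n return O -> ms_type (Rspace R n) with
  | 0 => fun _ => tt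
  | n.+1 => fun w => (xivec xi n w, xi n w)
  end.

Definition is_density (R : realType) d (T : measurableType d)
    (mu : {measure set T -> \bar R}) d' (O : measurableType d')
    (P : probability O R) (X : O -> T) (f : T -> R) : Prop :=
  [/\ measurable_fun setT X, measurable_fun setT f, (forall y, 0 <= f y) &
      forall A, measurable A ->
        P (X @^-1` A) = (\int[mu]_(y in A) (f y)%:E)%E].

Definition indep2 (R : realType) d' (O : measurableType d') (P : probability O R)
    d (T : measurableType d) (X : O -> R) (Y : O -> T) : Prop :=
  forall (A : set R) (B : set T), measurable A -> measurable B ->
    P (X @^-1` A `&` Y @^-1` B) = (P (X @^-1` A) * P (Y @^-1` B))%E.

Definition Dx0 (R : realType) d (O : measurableType d) (P : probability O R)
    (x0 : O -> R) : set R :=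
  if `[< P [set w | x0 w <= 0] = 0%E >] then `]0, +oo[%classic
  else if `[< P [set w | 0 <= x0 w] = 0%E >] then `]-oo, 0[%classic
  else setT.

Section KL.
Context (R : realType) d (O : measurableType d) (P : probability O R).
Local Notation leb := (@lebesgue_measure R).

Definition L2_process (t0 T : R) (a : R -> O -> R) : Prop :=
  [/\ (forall t, t \in `[t0, T] -> measurable_fun setT (a t)),
      measurable_fun (`[t0, T]%classic `*` setT) (fun p : R * O => a p.1 p.2) &
      (\int[(leb \x P)%E]_(p in `[t0, T]%classic `*` setT) ((a p.1 p.2) ^+ 2)%:E
        < +oo)%E].

Definition mean_a (a : R -> O -> R) (t : R) : R := fine ('E_P[a t])%E.

Definition cov_a (a : R -> O -> R) (t s : R) : R :=
  fine (covariance P (a t) (a s)).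

Definition cov_op (t0 T : R) (a : R -> O -> R) (f : R -> R) (t : R) : R :=
  \int[leb]_(s in `[t0, T]%classic) (cov_a a t s * f s).

(* index sets: M = None  -> infinitely many terms (all j : nat)
               M = Some m -> exactly m terms (j < m)                    *)
Definition validj (M : option nat) (j : nat) : bool :=
  if M is Some m then (j < m)%N else true.
Definition validN (M : option nat) (N : nat) : bool :=
  if M is Some m then (N <= m)%N else true.
Definition nterms (M : option nat) (N : nat) : nat :=
  if M is Some m then minn N m else N.

Definition KL_sum (a : R -> O -> R) (M : option nat) (nu : nat -> R)
    (phi : nat -> R -> R) (xi : nat -> O -> R) (N : nat) (t : R) (w : O) : R :=
  mean_a a t + \sum_(j < nterms M N) Num.sqrt (nu j) * phi j t * xi j w.

Record is_KL (t0 T : R) (a : R -> O -> R) (M : option nat) (nu : nat -> R)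
    (phi : nat -> R -> R) (xi : nat -> O -> R) : Prop := {
  (* eigenvalues are nonnegative; in the finite case the listed ones are
     exactly the nonzero ones *)
  KL_nu_ge0 : forall j, validj M j -> 0 <= nu j;
  KL_nu_fin : forall m, M = Some m -> forall j, (j < m)%N -> 0 < nu j;
  KL_phi_meas : forall j, validj M j -> measurable_fun `[t0, T]%classic (phi j);
  KL_phi_orthonormal : forall i j, validj M i -> validj M j ->
    \int[leb]_(s in `[t0, T]%classic) (phi i s * phi j s) = (i == j)%:R;
  KL_eigen : forall j, validj M j ->
    {ae leb, forall t, `[t0, T]%classic t ->
       cov_op t0 T a (phi j) t = nu j * phi j t};
  KL_basis : M = None -> forall f : R -> R, measurable_fun `[t0, T]%classic f ->
    (\int[leb]_(s in `[t0, T]%classic) (f s ^+ 2)%:E < +oo)%E ->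
    (forall j, \int[leb]_(s in `[t0, T]%classic) (f s * phi j s) = 0) ->
    {ae leb, forall t, `[t0, T]%classic t -> f t = 0};
  KL_xi_meas : forall j, validj M j -> measurable_fun setT (xi j);
  KL_xi_mean : forall j, validj M j -> ('E_P[xi j] = 0)%E;
  KL_xi_uncorr : forall i j, validj M i -> validj M j ->
    ('E_P[(fun w => (xi i w * xi j w)%R)] = ((i == j)%:R)%:E)%E;
  KL_cvg : (fun N => (\int[(leb \x P)%E]_(p in `[t0, T]%classic `*` setT)
               ((a p.1 p.2 - KL_sum a M nu phi xi N p.1 p.2) ^+ 2)%:E)%E)
           @ \oo --> 0%E }.

Definition K_a (t0 : R) (a : R -> O -> R) (nu : nat -> R) (phi : nat -> R -> R)
    (t : R) (n : nat) (y : ms_type (Rspace R n)) : R :=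
  \int[leb]_(s in `[t0, t]%classic)
     (mean_a a s + \sum_(j < n) Num.sqrt (nu j) * phi j s * coord y j).

(* f_1^N(x,t); for a finite expansion (M = Some m) the index is capped at m *)
Definition f1N (t0 : R) (a : R -> O -> R) (M : option nat) (nu : nat -> R)
    (phi : nat -> R -> R) (f0 : R -> R)
    (fxi : forall n, ms_type (Rspace R n) -> R) (x t : R) (N : nat) : \bar R :=
  let n := nterms M N in
  (\int[ms_meas (Rspace R n)]_y
     (f0 (x * expR (- K_a t0 a nu phi t y)) * fxi n y
        * expR (- K_a t0 a nu phi t y))%:E)%E.

Definition xsol (t0 : R) (x0 : O -> R) (a : R -> O -> R) (t : R) (w : O) : R :=
  x0 w * expR (\int[leb]_(s in `[t0, t]%classic) a s w).

End KL.

(* Main.v *)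
(* Write K(w) for the integral of a(., w) over [t0, t], K_N for its
   Karhunen-Loeve truncation and h_x(k) = f0(x e^-k) e^-k. Then f_1^N(x, t) is
   E[h_x(K_N)]. The L2 convergence of the expansion gives E|K_N - K| -> 0, and
   for x in the support h_x is continuous and bounded by C / |x|, so
   E[h_x(K_N)] -> E[h_x(K)]. The same passage to the limit shows that x0, being
   independent of every K_N, is independent of K; a change of variables and
   Tonelli's theorem then identify E[h_x(K)] as the density of x0 e^K at x.
   For x outside the support f0 may take arbitrary values on a null set, and
   the limit is found by observing that K_N is an affine function of xi_N: it
   is either constant or has a law without mass on null sets. *)
Require Import Defs.
From HB Require Import structures.
From mathcomp Require Import all_boot all_order all_algebra.
From mathcomp Require Import all_classical all_reals all_analysis.
From mathcomp Require Import measurable_realfun.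
From mathcomp Require Import ring lra.
Import Order.TTheory GRing.Theory Num.Theory.
Import numFieldNormedType.Exports.
Local Open Scope classical_set_scope.
Local Open Scope ring_scope.
Set Implicit Arguments.
Unset Strict Implicit.
Unset Printing Implicit Defensive.

(** * Lebesgue measure under affine maps, and null sets *)

(** The claim is pointwise in x, while a density is determined only up to null sets; this dictates
    the choice of f1. Multiplication by e^-k preserves the support, so for a fixed x the function
    h_x samples f0 either only where the hypotheses control it or only outside, whatever the value
    of k, and the two cases never mix. On the support only L1 convergence of K_N is at hand, not
    almost sure convergence, and h_x need not be uniformly continuous. Hence an explicit estimate: a
    modulus of continuity on a segment, and terms of Markov type for large values of K and for large
    differences. Indicators are not continuous, so independence passes to the limit through
    continuous ramps increasing to indicators of rays. Off the support the case of constant K_N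
    cannot be dismissed: at t = t0 every K_N is 0 and f_1^N(x, t0) = f0(x), so f1 has to reproduce
    f0 there. This alters f1 on a null set only. *)

Section affine.
Context (R : realType).
Notation leb := (@lebesgue_measure R).
Notation mR := (measurableTypeR R).

Let measurable_affine (a b : R) :
  measurable_fun [set: mR] ((fun x : R => a * x + b) : mR -> mR).
Proof. by apply: measurable_funD => //; apply: measurable_funM. Qed.

Let affine_measure (a b : R) : {measure set mR -> \bar R} :=
  mscale (NngNum (normr_ge0 a))
    (measure_function_pushforward__canonical__measure_function_Measure leb
      (measurable_affine a b)).

(** By uniqueness of Lebesgue measure it suffices to compare half-open intervals. A negative slope
    turns []u, v]] into an interval closed on the left, of the same length formula. *)
Lemma lebesgue_measure_affine (a b : R) (A : set R) : a != 0 -> measurable A ->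
  leb A = (`|a|%:E * leb ((fun x => a * x + b)%R @^-1` A))%E.
Proof.
move=> a0 mA; rewrite (@lebesgue_measure_unique _ (affine_measure a b) _ A mA)//.
move=> _ [[u v]] _ <- /=; rewrite /mscale/= /pushforward.
have [apos|aneg] : 0 < a \/ a < 0 by case: (ltgtP a 0) a0; [right|left|].
- have -> : (fun x => a * x + b) @^-1` `]u, v] = `](u - b) / a, (v - b) / a]%classic.
    apply/seteqP; split=> x /=; rewrite !in_itv/= ltr_pdivrMr// ler_pdivlMr//;
      by rewrite ltrBlDr lerBrDr mulrC.
  rewrite !lebesgue_measure_itv/= !lte_fin ltr_pM2r ?invr_gt0// ltrD2r.
  case: ifPn => _; last by rewrite mule0.
  rewrite -!EFinD -EFinM gtr0_norm//; congr EFin; field; lra.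
- have -> : (fun x => a * x + b) @^-1` `]u, v] = `[(v - b) / a, (u - b) / a[%classic.
    apply/seteqP; split=> x /=; rewrite !in_itv/= ltr_ndivlMr// ler_ndivrMr//;
      by rewrite ltrBlDr lerBrDr mulrC andbC.
  rewrite !lebesgue_measure_itv/= !lte_fin ltr_nM2r ?invr_lt0// ltrD2r.
  case: ifPn => _; last by rewrite mule0.
  rewrite -!EFinD -EFinM ltr0_norm//; congr EFin; field; lra.
Qed.

Lemma lebesgue_null_affine (a b : R) (A : set R) : a != 0 -> measurable A ->
  leb A = 0%E -> leb ((fun x => a * x + b) @^-1` A) = 0%E.
Proof.
move=> a0 mA; rewrite (@lebesgue_measure_affine a b)// => /eqP.
rewrite mule_eq0 => /orP[|/eqP//].
by rewrite eqe normr_eq0 (negbTE a0).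
Qed.

Lemma ge0_integral_scale (c : R) (A : set R) (f : R -> R) : 0 < c ->
  measurable A -> measurable_fun setT f -> (forall x, 0 <= f x) ->
  (\int[leb]_(u in (fun u => u * c)%R @^-1` A) (f u)%:E =
   \int[leb]_(x in A) (f (x / c) / c)%:E)%E.
Proof.
move=> c0 mA mf f0.
have mB : measurable ((fun u => u * c)%R @^-1` A).
  rewrite -[X in measurable X]setTI.
  by apply: (measurable_funM (@measurable_id _ _ _) (@measurable_cst _ _ _ _ _ _)).
have ci : c^-1 != 0 by rewrite invr_neq0// gt_eqF.
(* Lebesgue measure is rewritten as a scaled image of itself under division by [c]; the image then
   moves into the integrand. *)
rewrite (eq_measure_integral (affine_measure c^-1 0)); last first.
  by move=> B mB' _; exact: (lebesgue_measure_affine 0 ci mB').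
rewrite /affine_measure ge0_integral_mscale//=; last 2 first.
  by apply/measurable_EFinP; exact: measurable_funTS.
  by move=> x _; rewrite lee_fin.
rewrite ge0_integral_pushforward//; last 2 first.
  by apply/measurable_EFinP; exact: measurable_funTS.
  by move=> x _; rewrite lee_fin.
rewrite gtr0_norm ?invr_gt0//.
have -> : (fun x => c^-1 * x + 0) @^-1` ((fun u => u * c)%R @^-1` A) = A.
  by apply/seteqP; split=> x /=; rewrite addr0 mulrAC mulVf ?mul1r// gt_eqF.
rewrite -ge0_integralZl_EFin//=.
- by apply: eq_integral => x _; rewrite addr0 -EFinM mulrC [x / c]mulrC.
- by move=> x _; rewrite lee_fin.
- apply/measurable_EFinP/measurable_funTS; apply: (measurableT_comp mf).
  exact: measurable_affine.
- by rewrite invr_ge0 ltW.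
Qed.

End affine.

(** * Expectations computed through a density *)

Section transfer.
Local Open Scope ereal_scope.
Context d d' (O : measurableType d) (T : measurableType d') (R : realType).
Variables (m : {measure set O -> \bar R}) (mu : {measure set T -> \bar R}).
Variables (X : O -> T) (D : set O) (f : T -> R).
Hypothesis mX : measurable_fun setT X.
Hypothesis mD : measurable D.
Hypothesis mf : measurable_fun setT f.
Hypothesis f0 : forall y, (0 <= f y)%R.
Hypothesis XfE : forall B, measurable B ->
  m (D `&` X @^-1` B) = \int[mu]_(y in B) (f y)%:E.

Import HBNNSimple.

(** Simple functions and monotone convergence. The event [D] and the arbitrary reference measure
    [mu] let one statement serve both the density of the random vector and the factorisation under
    independence. *)
Lemma ge0_integral_density (g : T -> \bar R) :
  measurable_fun setT g -> (forall y, 0 <= g y) ->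
  \int[m]_(w in D) g (X w) = \int[mu]_y (g y * (f y)%:E).
Proof.
move=> mg g0.
pose g_ := nnsfun_approx measurableT mg.
have gcvg y : EFin \o g_ ^~ y @ \oo --> g y by exact: cvg_nnsfun_approx.
have mpre B : measurable B -> measurable (X @^-1` B).
  by move=> mB; rewrite -[X in measurable X]setTI; exact: mX.
transitivity (limn (fun n => \int[m]_(w in D) (g_ n (X w))%:E)).
  rewrite -monotone_convergence//.
  - by apply: eq_integral => w _; apply/esym/cvg_lim => //; exact: gcvg.
  - move=> n; apply/measurable_EFinP/measurable_funTS.
    exact: (measurableT_comp _ mX).
  - by move=> n y _; rewrite lee_fin.
  - by move=> y _ i j ij; rewrite lee_fin; exact/lefP/nd_nnsfun_approx.
transitivity (limn (fun n => \int[mu]_y ((g_ n y)%:E * (f y)%:E))); last first.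
  rewrite -monotone_convergence//.
  - apply: eq_integral => y _; apply/cvg_lim => //.
    by apply: cvgeZr => //; exact: gcvg.
  - by move=> n; apply: emeasurable_funM; exact/measurable_EFinP.
  - by move=> n y _; rewrite mule_ge0// lee_fin.
  - move=> y _ i j ij; apply: lee_wpmul2r; rewrite lee_fin//.
    exact/lefP/nd_nnsfun_approx.
congr (limn _); apply/funext => n.
transitivity (\sum_(k \in range (g_ n))
    \int[m]_(w in D) (k * \1_(X @^-1` (g_ n @^-1` [set k])) w)%:E).
  under eq_integral do rewrite fimfunE -fsumEFin//.
  rewrite ge0_integral_fsum//.
  - move=> k; apply/measurable_EFinP/measurable_funM => //.
    by apply: measurable_indic; exact: mpre.
  - by move=> k x _; rewrite nnfun_muleindic_ge0.
transitivity (\sum_(k \in range (g_ n))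
    \int[mu]_y ((k * \1_(g_ n @^-1` [set k]) y)%:E * (f y)%:E)); last first.
  rewrite -ge0_integral_fsum//.
  - apply: eq_integral => y _; rewrite fimfunE -fsumEFin//.
    rewrite ge0_mule_fsuml// => k; by rewrite nnfun_muleindic_ge0.
  - move=> k; apply: emeasurable_funM; apply/measurable_EFinP => //.
    exact: measurable_funM.
  - by move=> k x _; rewrite mule_ge0 ?nnfun_muleindic_ge0 ?lee_fin.
apply: eq_fsbigr => k _.
have mk : measurable (g_ n @^-1` [set k]) by [].
have [k0|k0] := ltP k 0%R.
  rewrite preimage_nnfun0// preimage_set0.
  rewrite !integral0_eq// => y _; rewrite indicE in_set0 mulr0// mul0e.
  by [].
under eq_integral do rewrite EFinM.
rewrite ge0_integralZl_EFin//; last first.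
  - by apply/measurable_EFinP/measurable_indic; exact: mpre.
under [in RHS]eq_integral do rewrite EFinM -muleA.
rewrite ge0_integralZl_EFin//; last 2 first.
  - by move=> y _; rewrite mule_ge0 ?lee_fin.
  - by apply: emeasurable_funM; exact/measurable_EFinP.
congr (_ * _).
rewrite integral_indic//; last exact: mpre.
rewrite setIC XfE// integral_mkcond; apply: eq_integral => y _.
rewrite patchE indicE; case: ifPn; rewrite ?mul1e ?mul0e//.
Qed.
End transfer.

(** * Null sets pulled back through exponentials and affine forms *)

Section null_sets.
Context (R : realType).
Notation leb := (@lebesgue_measure R).

(* By scaling, {u | Z (u * e^k)} is null for every k, so by Tonelli
   {k | Z (u * e^k)} is null for almost every u; by translation invariance the
   measure of the latter set only depends on the sign of u. *)
Lemma lebesgue_null_expR (x : R) (Z : set R) : x != 0 -> measurable Z ->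
  leb Z = 0%E -> leb ((fun k => x * expR k) @^-1` Z) = 0%E.
Proof.
move=> x0 mZ Z0.
pose G u := leb ((fun k => u * expR k) @^-1` Z).
have mphi : measurable_fun setT (fun z : R * R => z.1 * expR z.2).
  apply: measurable_funM => //.
  by apply: measurableT_comp => //; exact: measurable_expR.
have mF : measurable_fun setT (fun z : R * R => (\1_Z (z.1 * expR z.2))%:E : \bar R).
  by apply/measurable_EFinP; exact: measurableT_comp.
have F0 z : (0 <= (\1_Z (z.1 * expR z.2))%:E :> \bar R)%E by rewrite lee_fin.
have mpre1 u : measurable ((fun k => u * expR k) @^-1` Z).
  rewrite -[X in measurable X]setTI.
  by apply: (measurable_funM (@measurable_cst _ _ _ _ _ _) (@measurable_expR _)).
have mpre2 (k : R) : measurable ((fun u => u * expR k) @^-1` Z).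
  rewrite -[X in measurable X]setTI.
  by apply: (measurable_funM (@measurable_id _ _ _) (@measurable_cst _ _ _ _ _ _)).
have GE u : G u = (\int[leb]_k ((\1_Z (u * expR k))%:E : \bar R))%E.
  by rewrite /G -[X in leb X]setIT -integral_indic//; exact: mpre1.
have intG : (\int[leb]_u G u = 0)%E.
  transitivity (\int[leb]_u \int[leb]_k ((\1_Z (u * expR k))%:E : \bar R))%E.
    by apply: eq_integral => u _.
  rewrite [LHS](@fubini_tonelli _ _ _ _ _ leb leb _ mF F0)/=.
  apply: integral0_eq => k _.
  transitivity (leb ((fun u => u * expR k) @^-1` Z)).
    by rewrite -[X in leb X]setIT -integral_indic//; exact: mpre2.
  have -> : (fun u => u * expR k) @^-1` Z = (fun u => expR k * u + 0) @^-1` Z.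
    by apply/seteqP; split=> u /=; rewrite addr0 mulrC.
  by apply: lebesgue_null_affine => //; rewrite gt_eqF// expR_gt0.
(* The points strictly between 0 and [x]: a set of positive measure on which u = x e^s with s = ln
   (u / x), so that [G] is constant there. Its integral being 0, the constant is 0. *)
pose I := (fun u => x^-1 * u + 0) @^-1` `]0, 1[%classic.
have mI : measurable I.
  rewrite -[I]setTI; apply: (@measurable_funD _ _ _ _ (fun u => x^-1 * u) (cst 0)) => //.
  exact: measurable_funM.
have xi0 : x^-1 != 0 by rewrite invr_neq0.
have I0 : leb I != 0%E.
  have := lebesgue_measure_affine 0 xi0 (measurable_itv `]0, 1[).
  rewrite -/I lebesgue_measure_itv/= lte_fin ltr01 => E.
  by apply/eqP => I0; move: E; rewrite I0 mule0 sube0 => /eqP; rewrite eqe oner_eq0.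
have GI u : I u -> G u = G x.
  rewrite /I/= in_itv/= addr0 => /andP[u0 _].
  pose s := ln (x^-1 * u).
  have es : expR s = x^-1 * u by rewrite lnK.
  rewrite /G.
  have := lebesgue_measure_affine s (oner_neq0 R) (mpre1 x).
  rewrite normr1 mul1e => ->; congr (leb _).
  have E k : x * expR (1 * k + s) = u * expR k by rewrite mul1r expRD es; field.
  by apply/seteqP; split => k /=; rewrite E.
have mG : measurable_fun setT G.
  rewrite [G](_ : _ = (fun u => \int[leb]_k ((\1_Z (u * expR k))%:E : \bar R))%E).
    exact: (@measurable_fun_fubini_tonelli_F _ _ _ _ _ leb _ mF F0).
  by apply/funext => u.
have : (\int[leb]_(u in I) G u = 0)%E.
  apply/eqP; rewrite eq_le integral_ge0// andbT -intG.
  exact: ge0_subset_integral.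
rewrite (eq_integral (cst (G x))); last by move=> u; rewrite inE => /GI.
rewrite integral_cst// => /eqP; rewrite mule_eq0 (negbTE I0) orbF => /eqP.
by [].
Qed.

(** One coefficient sequence serves all dimensions, so passing from [n] to [n.+1] only adds a term
    in the last coordinate. *)
Definition affine_form (n : nat) (b : R) (c : nat -> R) (y : ms_type (Rspace R n)) : R :=
  b + \sum_(j < n) c j * Defs.coord y j.

Lemma affine_formS n b c (y : ms_type (Rspace R n.+1)) :
  affine_form b c y = affine_form b c y.1 + c n * y.2.
Proof.
rewrite /affine_form big_ord_recr/= eqxx addrA; congr (_ + _ + _).
apply: eq_bigr => j _; rewrite ifF//; apply/negbTE.
by rewrite neq_ltn ltn_ord.
Qed.

Lemma measurable_affine_form n b c :
  measurable_fun setT (@affine_form n b c).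
Proof.
elim: n => [|n IH] /=.
  rewrite (_ : @affine_form 0 b c = cst b); first exact: measurable_cst.
  by apply/funext => y; rewrite /affine_form big_ord0 addr0.
rewrite (_ : @affine_form n.+1 b c =
  (fun y : ms_type (Rspace R n) * R => affine_form b c y.1 + c n * y.2)).
  apply: measurable_funD; first exact: (measurableT_comp IH).
  exact: measurable_funM.
by apply/funext => y; rewrite affine_formS.
Qed.

(** Slicing along the last coordinate: if [c n] is nonzero, each slice is the preimage of [Z] under
    a nonconstant affine map of the line; if it is 0, the slice is empty outside a set that is null
    by induction. *)
Lemma affine_form_null n b c (Z : set R) : (exists2 j, (j < n)%N & c j != 0) ->
  measurable Z -> leb Z = 0%E ->
  ms_meas (Rspace R n) (@affine_form n b c @^-1` Z) = 0%E.
Proof.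
move=> + mZ Z0; elim: n => [[]//|n IH [j jn cj]].
have mL := @measurable_affine_form n.+1 b c.
have mpre : measurable (@affine_form n.+1 b c @^-1` Z).
  by rewrite -[X in measurable X]setTI; exact: mL.
have xs x : leb (xsection (@affine_form n.+1 b c @^-1` Z) x) =
    leb ((fun v => c n * v + affine_form b c x) @^-1` Z).
  congr (leb _); apply/seteqP; split=> v; rewrite /xsection/= inE/=;
    by rewrite affine_formS addrC.
rewrite /= /product_measure1/=.
have [cn0|cn0] := eqVneq (c n) 0; last first.
  by apply: integral0_eq => x _; rewrite xs lebesgue_null_affine.
have N0 : ms_meas (Rspace R n) (@affine_form n b c @^-1` Z) = 0%E.
  apply: IH; exists j => //; rewrite ltn_neqAle -ltnS jn andbT.
  by apply: contra_neq cj => ->.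
rewrite (ge0_negligible_integral _ _ _ _ N0)//.
- apply: integral0_eq => x [_ /= nZ]; rewrite xs cn0.
  rewrite (_ : _ @^-1` Z = set0) ?measure0//.
  by apply/seteqP; split=> v //=; rewrite mul0r add0r.
- by rewrite -[X in measurable X]setTI; exact: measurable_affine_form.
- exact: measurable_fun_xsection.
Qed.

End null_sets.

(** * Bounded continuous functionals and L1 convergence *)

Section L1_convergence.
Context (R : realType).

Lemma ge0_cvge0P (u : nat -> \bar R) : (forall n, 0 <= u n)%E ->
  (u @ \oo --> 0%E) <->
  (forall e : R, 0 < e -> \forall n \near \oo, (u n <= e%:E)%E).
Proof.
move=> u0; split.
  move=> /fine_cvgP[ufin /cvgrPdist_le uc] e e0; near=> n.
  have un : u n \is a fin_num by near: n.
  rewrite -(fineK un) lee_fin -[fine _]ger0_norm ?fine_ge0//.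
  by rewrite -normrN -sub0r; near: n; exact: uc.
move=> uc; apply/fine_cvgP; split.
  near=> n; rewrite ge0_fin_numE//; apply: (@le_lt_trans _ _ 1%:E); last exact: ltry.
  by near: n; exact: uc.
apply/cvgrPdist_le => e e0; near=> n.
have une : (u n <= e%:E)%E by near: n; exact: uc.
have un : u n \is a fin_num by rewrite ge0_fin_numE// (le_lt_trans une)// ltry.
rewrite sub0r normrN/= ger0_norm ?fine_ge0//.
by rewrite -lee_fin fineK.
Unshelve. all: end_near. Qed.

(** Only [v] is confined to the segment: in the application it is the limit variable, the only one
    whose size is controlled, and [u] may leave the segment. Compactness makes the pointwise choices
    of [del] uniform. *)
Lemma continuous_segment_modulus (h : R -> R) (r e : R) :
  continuous h -> 0 < e ->
  exists2 del, 0 < del &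
    forall u v, `|v| <= r -> `|u - v| < del -> `|h u - h v| <= e.
Proof.
move=> ch e0.
have /compact_near_coveringP/(_ R (0^'+)
  (fun del v => forall u, `|u - v| < del -> `|h u - h v| <= e)) :=
  @segment_compact R (- r) r.
have FF : Filter (0^'+ : set_system R) by exact: at_right_proper_filter.
case/(_ FF).
  move=> v0 _.
  have /cvgrPdist_le/(_ (e / 2)) := ch v0.
  rewrite divr_gt0// => /(_ isT)/nbhs_ballP[/= s s0 hs].
  exists (ball v0 (s / 2), [set del | del < s / 2]) => /=.
    split; first by apply: nbhsx_ballx; rewrite divr_gt0.
    by apply: nbhs_right_lt; rewrite divr_gt0.
  move=> [v del]/= [v0v dels] u uv.
  have hv : `|h v0 - h v| <= e / 2.
    by apply: hs; apply: le_ball v0v; rewrite ler_pdivrMr// ler_peMr ?ltW// ltr1n.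
  have hu : `|h v0 - h u| <= e / 2.
    apply: hs; rewrite /ball/=; move: v0v; rewrite /ball/= => v0v.
    have -> : v0 - u = (v0 - v) - (u - v) by ring.
    apply: (le_lt_trans (ler_normB _ _)).
    rewrite [s]splitr; apply: ltrD => //; exact: lt_trans dels.
  have -> : h u - h v = (h v0 - h v) - (h v0 - h u) by ring.
  by rewrite (le_trans (ler_normB _ _))// [e]splitr lerD.
move=> del /= del0 Hdel.
exists (del / 2); first by rewrite divr_gt0.
move=> u v vr uv.
apply: (Hdel (del / 2)) => //=.
- by rewrite /ball/= sub0r normrN gtr0_norm ?divr_gt0// ltr_pdivrMr// ltr_pMr// ltr1n.
- by rewrite divr_gt0.
- by rewrite in_itv/= -ler_norml.
Qed.

Context d (O : measurableType d) (P : probability O R).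

Lemma bounded_integrable_comp (D : set O) (B : R) (h : R -> R) (u : O -> R) :
  measurable D -> measurable_fun setT h -> (forall k, 0 <= h k <= B) ->
  measurable_fun setT u -> P.-integrable D (EFin \o (h \o u)).
Proof.
move=> mD mh hB mu; apply: measurable_bounded_integrable => //.
- by rewrite (le_lt_trans (probability_le1 P mD))// ltry.
- by apply: measurable_funTS; exact: measurableT_comp.
- exists B; split; first exact: num_real.
  move=> M BM w _ /=; have /andP[h0 hb] := hB (u w).
  by rewrite ger0_norm// (le_trans hb)// ltW.
Qed.

(* Bounded continuous functionals pass to the limit by integrating
   |h u - h v| <= e + (B / r) |v| + (B / del) |u - v|,
   where del is a modulus of continuity of h for e on [-r, r]. *)
Lemma cvg_integral_comp (D : set O) (B : R) (h : R -> R) (u_ : nat -> O -> R)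
    (u : O -> R) :
  measurable D -> continuous h -> (forall k, 0 <= h k <= B) ->
  (forall n, measurable_fun setT (u_ n)) -> measurable_fun setT u ->
  (\int[P]_w `|u w|%:E < +oo)%E ->
  (fun n => \int[P]_w `|u_ n w - u w|%:E)%E @ \oo --> 0%E ->
  (fun n => \int[P]_(w in D) (h (u_ n w))%:E)%E @ \oo -->
    (\int[P]_(w in D) (h (u w))%:E)%E.
Proof.
move=> mD ch hB mu_ mu uoo /ge0_cvge0P-/(_ (fun=> integral_ge0 _ _)) u_u.
have mh : measurable_fun setT h by exact: continuous_measurable_fun.
have {u_u} u_u e : 0 < e -> \forall n \near \oo, (\int[P]_w `|u_ n w - u w|%:E <= e%:E)%E.
  by apply: u_u => *; rewrite lee_fin.
have B0 : 0 <= B by have /andP[/le_trans] := hB 0; apply.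
have ih v : measurable_fun setT v -> P.-integrable D (EFin \o (h \o v)).
  exact: (bounded_integrable_comp mD mh hB).
have fin v : measurable_fun setT v -> (\int[P]_(w in D) (h (v w))%:E)%E \is a fin_num.
  by move=> mv; apply: integrable_fin_num => //; exact: ih.
rewrite -(fineK (fin _ mu)); apply/fine_cvgP; split.
  by near=> n; exact: fin.
apply/cvgrPdist_le => e e0.
pose I := fine (\int[P]_w `|u w|%:E).
have IE : I%:E = (\int[P]_w `|u w|%:E)%E.
  by rewrite fineK// ge0_fin_numE// integral_ge0.
have I0 : 0 <= I by rewrite fine_ge0// integral_ge0.
(* Makes the term in |v| integrate to at most [e / 3]; the [1 +] keeps [r] positive when [B * I] is
   0. *)
pose r := (1 + B * I) / (e / 3).
have r0 : 0 < r by rewrite divr_gt0 ?ltr_wpDr ?divr_gt0// mulr_ge0.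
have e30 : 0 < e / 3 by rewrite divr_gt0.
have [del del0 hdel] := continuous_segment_modulus r ch e30.
(* The modulus handles close arguments with [l] in the segment. Otherwise |l| > r or |k - l| >= del,
   and one of the last two terms alone reaches [B], which bounds the left side. *)
have key k l : `|h k - h l| <= e / 3 + B / r * `|l| + B / del * `|k - l|.
  have hB' : `|h k - h l| <= B.
    have /andP[? ?] := hB k; have /andP[? ?] := hB l.
    by rewrite ler_norml; apply/andP; split; lra.
  have p1 : 0 <= B / r * `|l| by rewrite mulr_ge0// divr_ge0// ltW.
  have p2 : 0 <= B / del * `|k - l| by rewrite mulr_ge0// divr_ge0// ltW.
  have [lr|rl] := leP `|l| r.
    have [kl|kl] := ltP `|k - l| del.
      by have := hdel _ _ lr kl; lra.
    have : B <= B / del * `|k - l|.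
      by rewrite -mulrA ler_peMr// mulrC ler_pdivlMr// mul1r.
    lra.
  have : B <= B / r * `|l|.
    by rewrite -mulrA ler_peMr// mulrC ler_pdivlMr// mul1r ltW.
  lra.
(* The closeness required of [u_ n] to [u] in L1, bringing the last term below [e / 3]; the [+ 1]
   covers [B = 0]. *)
have e3 : 0 < (e / 3) / (B / del + 1).
  by rewrite divr_gt0// ltr_wpDl// divr_ge0// ltW.
have c1 : 0 <= e / 3 by rewrite ltW.
have c2 : 0 <= B / r by rewrite divr_ge0// ltW.
have c3 : 0 <= B / del by rewrite divr_ge0// ltW.
near=> n.
have un : (\int[P]_w `|u_ n w - u w|%:E <= ((e / 3) / (B / del + 1))%:E)%E.
  by near: n; exact: u_u.
rewrite /= -[X in `|X - _|]/(\int[P]_(w in D) (h (u w))).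
rewrite -[X in `|_ - X|]/(\int[P]_(w in D) (h (u_ n w))).
rewrite -RintegralB//; [|exact: ih..].
have mdiff : measurable_fun setT (fun w => h (u w) - h (u_ n w)).
  by apply: measurable_funB; exact: measurableT_comp.
have mdu : measurable_fun setT (fun w => `|u_ n w - u w|).
  by apply: measurableT_comp => //; exact: measurable_funB.
have mnu : measurable_fun setT (fun w => `|u w|) by exact: measurableT_comp.
rewrite -lee_fin EFin_normr_Rintegral//; last first.
  rewrite [X in P.-integrable _ X](_ : _ =
    (EFin \o (h \o u)) \- (EFin \o (h \o u_ n)))%E//.
  by apply: integrableB => //; exact: ih.
apply: (le_trans (le_abse_integral P mD _)).
  by apply/measurable_EFinP/measurable_funTS.
apply: (@le_trans _ _ (\int[P]_w ((e / 3)%:E + (B / r)%:E * `|u w|%:E +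
  (B / del)%:E * `|u_ n w - u w|%:E))%E).
  apply: (@le_trans _ _ (\int[P]_w `|h (u w) - h (u_ n w)|%:E)%E).
    apply: ge0_subset_integral => //; apply/measurable_EFinP.
    exact: measurableT_comp.
  apply: ge0_le_integral => //.
  - by apply/measurable_EFinP; exact: measurableT_comp.
  - apply/measurable_EFinP; apply: measurable_funD; last exact: measurable_funM.
    by apply: measurable_funD => //; exact: measurable_funM.
  - by move=> w _; rewrite -!EFinM -!EFinD lee_fin distrC.
have f2_ge0 w : (0 <= (B / r)%:E * `|u w|%:E)%E by rewrite mule_ge0 ?lee_fin.
have f3_ge0 w : (0 <= (B / del)%:E * `|u_ n w - u w|%:E)%E.
  by rewrite mule_ge0 ?lee_fin.
have mf2 : measurable_fun setT (fun w => (B / r)%:E * `|u w|%:E)%E.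
  by apply/measurable_EFinP; exact: measurable_funM.
have mf3 : measurable_fun setT (fun w => (B / del)%:E * `|u_ n w - u w|%:E)%E.
  by apply/measurable_EFinP; exact: measurable_funM.
rewrite ge0_integralD//; last 2 first.
- by move=> w _; rewrite adde_ge0// lee_fin.
- exact: emeasurable_funD.
rewrite ge0_integralD//.
have -> : (\int[P]_w (e / 3)%:E = (e / 3)%:E)%E.
  rewrite [LHS](integral_cst P measurableT (e / 3)%:E) -[RHS]mule1.
  by congr (_ * _)%E; exact: probability_setT.
rewrite ge0_integralZl_EFin//; last exact/measurable_EFinP.
rewrite ge0_integralZl_EFin//; last exact/measurable_EFinP.
rewrite -IE -EFinM.
apply: (@le_trans _ _ ((e / 3)%:E + (B / r * I)%:E +
  (B / del)%:E * ((e / 3) / (B / del + 1))%:E)%E).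
  by rewrite leeD2l// lee_wpmul2l// lee_fin divr_ge0// ltW.
rewrite -EFinM -!EFinD lee_fin.
have q1 : B / r * I <= e / 3.
  rewrite mulrAC ler_pdivrMr// /r mulrCA divff ?gt_eqF// mulr1.
  by rewrite lerDr.
have q2 : B / del * ((e / 3) / (B / del + 1)) <= e / 3.
  rewrite mulrCA ler_piMr ?(ltW e30)// ler_pdivrMr ?mul1r ?lerDl//.
  by rewrite ltr_wpDl// divr_ge0// ltW.
lra.
Unshelve. all: end_near. Qed.

End L1_convergence.

(** * Independence and the density of a product *)

Section independence.
Context (R : realType) d (O : measurableType d) (P : probability O R).

Lemma measurable_preimageT d' (T : measurableType d') (X : O -> T) (B : set T) :
  measurable_fun setT X -> measurable B -> measurable (X @^-1` B).
Proof. by move=> mX mB; rewrite -[X in measurable X]setTI; exact: mX. Qed.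

Lemma probability_fin_num (D : set O) : measurable D -> P D \is a fin_num.
Proof.
by move=> mD; rewrite ge0_fin_numE// (le_lt_trans (probability_le1 P mD))// ltry.
Qed.

(** Independence says that [K], restricted to the event that [x0] lies in [A], has a constant
    density with respect to its own law, the constant being the probability of that event. *)
Lemma indep2_integral (x0 K : O -> R) (A : set R) (h : R -> R) :
  measurable_fun setT x0 -> measurable_fun setT K ->
  indep2 P x0 K -> measurable A -> measurable_fun setT h ->
  (forall k, 0 <= h k) ->
  (\int[P]_(w in x0 @^-1` A) (h (K w))%:E =
   P (x0 @^-1` A) * \int[P]_w (h (K w))%:E)%E.
Proof.
move=> mx0 mK xK mA mh h0.
have mD := measurable_preimageT mx0 mA.
pose c := fine (P (x0 @^-1` A)).
have cE : c%:E = P (x0 @^-1` A) by rewrite fineK// probability_fin_num.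
pose m := measure_function_pushforward__canonical__measure_function_Measure P mK.
have c0 : 0 <= c by rewrite fine_ge0.
have mhE : measurable_fun setT (EFin \o h) by exact/measurable_EFinP.
rewrite (@ge0_integral_density _ _ _ _ _ P m K (x0 @^-1` A) (cst c) mK mD
  _ _ _ (EFin \o h))//.
- rewrite /= ge0_integralZr//; last by move=> k _; rewrite lee_fin.
  rewrite -cE muleC; congr (_ * _)%E.
  by rewrite ge0_integral_pushforward// => k _; rewrite lee_fin.
- move=> B mB; rewrite [LHS](xK A B mA mB) -cE.
  by rewrite [RHS](integral_cst m mB c%:E).
Qed.

(** Continuous, and increasing with [n] to the indicator of the open ray []b, +oo[]. *)
Definition ramp (b : R) (n : nat) (k : R) : R :=
  Num.min 1 (Num.max 0 (n%:R * (k - b))).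

Lemma ramp_bounded b n k : 0 <= ramp b n k <= 1.
Proof. by rewrite /ramp le_min ler01 le_max lexx ge_min lexx. Qed.

Lemma ramp_continuous b n : continuous (ramp b n).
Proof.
move=> k; rewrite /ramp.
apply: (@continuous_min _ _ (cst 1) (fun k => Num.max 0 (n%:R * (k - b)))).
  exact: cst_continuous.
apply: (@continuous_max _ _ (cst 0) (fun k => n%:R * (k - b))).
  exact: cst_continuous.
apply: cvgM; first exact: cvg_cst.
by apply: cvgB; [exact: cvg_id|exact: cvg_cst].
Qed.

Lemma cvg_integral_ramp (K : O -> R) b (D : set O) :
  measurable D -> measurable_fun setT K ->
  (\int[P]_(w in D) (ramp b n (K w))%:E)%E @[n --> \oo] -->
    P (D `&` K @^-1` `]b, +oo[).
Proof.
move=> mD mK.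
have mB : measurable (K @^-1` `]b, +oo[) by exact: measurable_preimageT.
rewrite setIC -(integral_indic P mD mB).
have mramp n : measurable_fun setT (ramp b n).
  exact: continuous_measurable_fun (@ramp_continuous b n).
rewrite [X in _ --> X](_ : _ = \int[P]_(w in D) (limn (fun n => (ramp b n (K w))%:E)))%E.
  apply: cvg_monotone_convergence => //.
  - by move=> n; apply/measurable_EFinP/measurable_funTS; exact: measurableT_comp.
  - by move=> n w _; rewrite lee_fin; have /andP[] := ramp_bounded b n (K w).
  - move=> w _ i j ij; rewrite lee_fin /ramp le_min ge_min lexx/=.
    rewrite ge_min; apply/orP; right; rewrite ge_max le_max lexx/= le_max.
    have [kb|kb] := leP (K w - b) 0; last by rewrite ler_pM2r// ler_nat ij orbT.
    by rewrite mulr_ge0_le0.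
apply: eq_integral => w _; apply/esym/cvg_lim => //.
have [bK|Kb] := ltP b (K w).
  rewrite indicE mem_set/=; last by rewrite in_itv/= bK.
  apply: cvg_near_cst; near=> n.
  rewrite /ramp; congr EFin; apply/min_idPl; rewrite le_max; apply/orP; right.
  rewrite -ler_pdivrMr ?subr_gt0//.
  by near: n; exact: nbhs_infty_ger.
rewrite indicE memNset/=; last by rewrite in_itv/= andbT => /lt_geF; rewrite Kb.
apply: cvg_near_cst; near=> n.
rewrite /ramp; congr EFin; rewrite (max_idPl _) ?(min_idPr _)//.
by rewrite mulr_ge0_le0// subr_le0.
Unshelve. all: end_near. Qed.

(** For fixed [A] both sides are finite measures in [B]; open rays are stable under intersection,
    generate the Borel sets and exhaust the line. *)
Lemma indep2_of_rays (x0 K : O -> R) : measurable_fun setT x0 -> measurable_fun setT K ->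
  (forall A b, measurable A -> P (x0 @^-1` A `&` K @^-1` `]b, +oo[) =
    (P (x0 @^-1` A) * P (K @^-1` `]b, +oo[))%E) ->
  indep2 P x0 K.
Proof.
move=> mx0 mK H A B mA mB.
have mD := measurable_preimageT mx0 mA.
pose c : {nonneg R} := NngNum (fine_ge0 (measure_ge0 P (x0 @^-1` A))).
have cE : c%:num%:E = P (x0 @^-1` A) by rewrite fineK// probability_fin_num.
pose m1 : {measure set R -> \bar R} :=
  measure_function_pushforward__canonical__measure_function_Measure (mrestr P mD) mK.
pose m2 : {measure set R -> \bar R} := mscale c
  (measure_function_pushforward__canonical__measure_function_Measure P mK).
have m12 : m1 B = m2 B.
  apply: (measure_unique (@RGenOInfty.G R) (fun n => `]- n%:R, +oo[%classic)) => //.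
  - exact: RGenOInfty.measurableE.
  - move=> _ _ [x ->] [y ->]; exists (Num.max x y).
    by apply/seteqP; split => k /=; rewrite !in_itv/= !andbT gt_max => /andP.
  - by move=> n; exists (- n%:R).
  - apply/seteqP; split => // k _.
    have [n kn] : exists n : nat, - k < n%:R.
      exists (Num.truncn `|k|).+1.
      by rewrite (le_lt_trans (ler_norm _))// normrN truncnS_gt.
    by exists n => //=; rewrite in_itv/= andbT ltrNl.
  - move=> _ [b ->]; rewrite /m1 /m2 /= /mscale/= /pushforward /mrestr -/(c%:num).
    by rewrite setIC H// -cE.
  - move=> n; apply: (@le_lt_trans _ _ 1%E); last exact: ltry.
    rewrite /m1/= /pushforward /mrestr; apply: probability_le1.
    by apply: measurableI => //; exact: measurable_preimageT.
move: m12; rewrite /m1 /m2 /= /mscale/= /pushforward /mrestr setIC => ->.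
by rewrite -cE.
Qed.

(** Two successive limits: with the ramp fixed, the product formula passes from [u_ N] to [u]; then
    the ramp increases to the indicator of a ray. *)
Lemma indep2_cvg (x0 : O -> R) (u_ : nat -> O -> R) (u : O -> R) :
  measurable_fun setT x0 ->
  (forall n, measurable_fun setT (u_ n)) -> measurable_fun setT u ->
  (\int[P]_w `|u w|%:E < +oo)%E ->
  (fun n => \int[P]_w `|u_ n w - u w|%:E)%E @ \oo --> 0%E ->
  (forall n, indep2 P x0 (u_ n)) -> indep2 P x0 u.
Proof.
move=> mx0 mu_ mu uoo u_u xu; apply: indep2_of_rays => // A b mA.
have mD := measurable_preimageT mx0 mA.
have H n : (\int[P]_(w in x0 @^-1` A) (ramp b n (u w))%:E =
    P (x0 @^-1` A) * \int[P]_w (ramp b n (u w))%:E)%E.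
  have c1 := @cvg_integral_comp _ _ _ P _ 1 (ramp b n) u_ u mD
    (@ramp_continuous b n) (ramp_bounded b n) mu_ mu uoo u_u.
  have c2 := @cvg_integral_comp _ _ _ P _ 1 (ramp b n) u_ u measurableT
    (@ramp_continuous b n) (ramp_bounded b n) mu_ mu uoo u_u.
  have {}c2 := cvgeZl (probability_fin_num mD) c2.
  have E : (fun N => \int[P]_(w in x0 @^-1` A) (ramp b n (u_ N w))%:E)%E =
      (fun N => P (x0 @^-1` A) * \int[P]_w (ramp b n (u_ N w))%:E)%E.
    apply/funext => N; apply: indep2_integral => //.
      exact: continuous_measurable_fun (@ramp_continuous b n).
    by move=> k; have /andP[] := ramp_bounded b n k.
  rewrite E in c1; exact: cvg_unique c1 c2.
have c1 := @cvg_integral_ramp u b _ mD mu.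
have c2 := @cvg_integral_ramp u b _ measurableT mu.
have {}c2 := cvgeZl (probability_fin_num mD) c2.
rewrite setTI in c2.
have E : (fun n => \int[P]_(w in x0 @^-1` A) (ramp b n (u w))%:E)%E =
    (fun n => P (x0 @^-1` A) * \int[P]_w (ramp b n (u w))%:E)%E.
  exact/funext.
rewrite E in c1; exact: cvg_unique c1 c2.
Qed.

End independence.

(** * Density of x0 times an independent exponential factor *)

Section density.
Context (R : realType) d (O : measurableType d) (P : probability O R).
Notation leb := (@lebesgue_measure R).

(* the density of x0 * expR k at x, for a constant k *)
Definition scaled_density (f0 : R -> R) (x k : R) : R :=
  f0 (x * expR (- k)) * expR (- k).

Lemma measurable_scaled_density d' (T : measurableType d') f0 (X K : T -> R) :
  measurable_fun setT f0 -> measurable_fun setT X -> measurable_fun setT K ->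
  measurable_fun setT (fun w => scaled_density f0 (X w) (K w)).
Proof.
move=> mf0 mX mK.
have mE : measurable_fun setT (fun w => expR (- K w)).
  apply: (measurableT_comp (@measurable_expR R)).
  exact: measurableT_comp.
apply: measurable_funM => //; apply: (measurableT_comp mf0).
exact: measurable_funM.
Qed.

Lemma scaled_density_ge0 f0 x k : (forall y, 0 <= f0 y) ->
  0 <= scaled_density f0 x k.
Proof. by move=> f00; rewrite mulr_ge0// expR_ge0. Qed.

(** By independence the law of the pair is the product of the two laws. The section of the event at
    K = k is [A] scaled by e^-k, whose probability under the law of [x0] is the integral of
    [scaled_density f0 x k] over [A]. *)
Lemma probability_mul_expR (x0 K : O -> R) (f0 : R -> R) (A : set R) :
  is_density leb P x0 f0 -> measurable_fun setT K -> indep2 P x0 K ->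
  measurable A ->
  P ((fun w => x0 w * expR (K w)) @^-1` A) =
  (\int[leb]_(x in A) \int[P]_w (scaled_density f0 x (K w))%:E)%E.
Proof.
move=> [mx0 mf0 f00 x0f0] mK xK mA.
pose X : {mfun O >-> R} := mfun_Sub (mem_set mx0).
pose Y : {mfun O >-> R} := mfun_Sub (mem_set mK).
have mZ : measurable_fun setT (fun w => (K w, x0 w)).
  exact/measurable_fun_pair.
pose m := measure_function_pushforward__canonical__measure_function_Measure P mZ.
pose C : set (R * R) := [set z | A (z.2 * expR z.1)].
have mC : measurable C.
  rewrite -[C]setTI.
  have mz : measurable_fun setT (fun z : R * R => z.2 * expR z.1).
    apply: measurable_funM => //; exact: (measurableT_comp (@measurable_expR R)).
  exact: mz.
transitivity (m C); first by [].
rewrite -(@product_measure_unique _ _ _ _ _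
  (distribution P Y) (distribution P X))//; last first.
  move=> B1 B2 mB1 mB2; rewrite /m/= /distribution /pushforward/=.
  by rewrite muleC -xK//; congr (P _); rewrite setIC.
rewrite /product_measure1/=.
transitivity (\int[P]_w \int[leb]_(x in A) (scaled_density f0 x (K w))%:E)%E; last first.
  have mF : measurable_fun setT
      (fun z : O * R => ((scaled_density f0 z.2 (K z.1)) * \1_A z.2)%:E).
    apply/measurable_EFinP/measurable_funM.
      by apply: measurable_scaled_density => //; exact: measurableT_comp.
    by apply: measurableT_comp => //; exact: measurable_indic.
  have F0 z : (0 <= ((scaled_density f0 z.2 (K z.1)) * \1_A z.2)%:E)%E.
    by rewrite lee_fin mulr_ge0// scaled_density_ge0.
  have patch w x : ((fun x => (scaled_density f0 x (K w))%:E) \_ A) x =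
      (scaled_density f0 x (K w) * \1_A x)%:E.
    by rewrite patchE indicE; case: ifPn => _; rewrite ?mulr1 ?mulr0.
  transitivity (\int[P]_w \int[leb]_x (scaled_density f0 x (K w) * \1_A x)%:E)%E.
    apply: eq_integral => w _; rewrite integral_mkcond.
    by apply: eq_integral => x _; rewrite patch.
  rewrite [LHS](@fubini_tonelli _ _ _ _ _ P leb _ mF F0)/=.
  rewrite [RHS]integral_mkcond; apply: eq_integral => x _.
  rewrite patchE; case: ifPn => xA.
    by apply: eq_integral => w _; rewrite indicE xA mulr1.
  by apply: integral0_eq => w _; rewrite indicE (negbTE xA) mulr0.
have mxs : measurable_fun setT (distribution P X \o xsection C).
  exact: measurable_fun_xsection.
rewrite /distribution.
rewrite (ge0_integral_pushforward mK P measurableT mxs)//=.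
apply: eq_integral => w _.
have xs : xsection C (K w) = (fun u => u * expR (K w)) @^-1` A.
  by apply/seteqP; split=> u; rewrite /xsection/= inE.
have mxsA : measurable ((fun u => u * expR (K w)) @^-1` A).
  by rewrite -xs; exact: measurable_xsection.
rewrite xs [LHS](x0f0 _ mxsA) ge0_integral_scale//; last exact: expR_gt0.
by apply: eq_integral => x _; rewrite /scaled_density expRN.
Qed.

End density.

(** * Karhunen-Loeve estimates *)

Section rectangle.
Local Open Scope ereal_scope.
Context d1 d2 (T1 : measurableType d1) (T2 : measurableType d2) (R : realType).
Variable m1 : {sigma_finite_measure set T1 -> \bar R}.
Variable m2 : {sigma_finite_measure set T2 -> \bar R}.

(** Splitting into positive and negative parts reduces to Tonelli, with no integrability of the
    sections; this is what paths of [a] call for. *)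
Lemma measurable_fun_integral2 (F : T1 * T2 -> \bar R) : measurable_fun setT F ->
  measurable_fun setT (fun x => \int[m2]_y F (x, y)).
Proof.
move=> mF; under eq_fun do rewrite integralE.
apply: emeasurable_funB.
- have := @measurable_fun_fubini_tonelli_F _ _ _ _ _ m2 (funepos F)
    (measurable_funepos mF) (funepos_ge0 F).
  apply: eq_measurable_fun => x _; apply: eq_integral => y _.
  by rewrite !funeposE.
- have := @measurable_fun_fubini_tonelli_F _ _ _ _ _ m2 (funeneg F)
    (measurable_funeneg mF) (funeneg_ge0 F).
  apply: eq_measurable_fun => x _; apply: eq_integral => y _.
  by rewrite !funenegE.
Qed.

Lemma measurable_fun_integral1 (F : T1 * T2 -> \bar R) : measurable_fun setT F ->
  measurable_fun setT (fun y => \int[m1]_x F (x, y)).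
Proof.
move=> mF; under eq_fun do rewrite integralE.
apply: emeasurable_funB.
- have := @measurable_fun_fubini_tonelli_G _ _ _ _ _ m1 (funepos F)
    (measurable_funepos mF) (funepos_ge0 F).
  apply: eq_measurable_fun => x _; apply: eq_integral => y _.
  by rewrite !funeposE.
- have := @measurable_fun_fubini_tonelli_G _ _ _ _ _ m1 (funeneg F)
    (measurable_funeneg mF) (funeneg_ge0 F).
  apply: eq_measurable_fun => x _; apply: eq_integral => y _.
  by rewrite !funenegE.
Qed.

Variable D : set T1.
Hypothesis mD : measurable D.
Notation DT := (D `*` [set: T2]).

Lemma measurable_strip : measurable DT.
Proof. exact: measurableX. Qed.

Lemma patch_strip (F : T1 * T2 -> \bar R) x y :
  (F \_ DT) (x, y) = ((fun x => F (x, y)) \_ D) x.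
Proof.
rewrite !patchE; have [xD|xD] := boolP (x \in D).
  by rewrite mem_set//; split => //; exact: set_mem.
by rewrite memNset// => -[/= /mem_set]; rewrite (negbTE xD).
Qed.

Lemma measurable_fun_strip (F : T1 * T2 -> \bar R) :
  measurable_fun DT F -> measurable_fun setT (F \_ DT).
Proof. by move=> mF; apply/(measurable_restrictT _ measurable_strip). Qed.

Lemma measurable_fun_strip_section (F : T1 * T2 -> \bar R) y :
  measurable_fun DT F -> measurable_fun D (fun x => F (x, y)).
Proof.
move=> mF; apply/(measurable_restrictT _ mD).
have := measurable_fun_pair1 y (measurable_fun_strip mF).
by under eq_fun do rewrite patch_strip.
Qed.

Lemma measurable_fun_strip_integral1 (F : T1 * T2 -> \bar R) :
  measurable_fun DT F -> measurable_fun setT (fun y => \int[m1]_(x in D) F (x, y)).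
Proof.
move=> /measurable_fun_strip/measurable_fun_integral1.
apply: eq_measurable_fun => y _; rewrite [RHS]integral_mkcond.
by apply: eq_integral => x _; rewrite patch_strip.
Qed.

Lemma measurable_fun_strip_integral2 (F : T1 * T2 -> \bar R) :
  measurable_fun DT F -> measurable_fun D (fun x => \int[m2]_y F (x, y)).
Proof.
move=> /measurable_fun_strip/measurable_fun_integral2/(measurable_funTS (D := D)).
apply: eq_measurable_fun => x xD.
by apply: eq_integral => y _; rewrite patch_strip patchE xD.
Qed.

Lemma measurable_fun_strip_fst d' (T' : measurableType d') (g : T1 -> T') :
  measurable_fun D g -> measurable_fun DT (fun z => g z.1).
Proof.
move=> mg _ B mB.
rewrite [X in measurable X](_ : _ = (D `&` g @^-1` B) `*` setT).
  by apply: measurableX => //; exact: mg.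
by apply/seteqP; split=> -[x y]/=; tauto.
Qed.

Lemma integral_strip1 (F : T1 * T2 -> \bar R) : measurable_fun DT F ->
  (forall z, 0 <= F z) ->
  \int[m1 \x m2]_(z in DT) F z = \int[m1]_(x in D) \int[m2]_y F (x, y).
Proof.
move=> mF F0; rewrite integral_mkcond fubini_tonelli1//; last 2 first.
- exact: measurable_fun_strip.
- by move=> z; rewrite patchE; case: ifPn.
rewrite [RHS]integral_mkcond; apply: eq_integral => x _ /=.
rewrite /fubini_F patchE; case: ifPn => xD.
  by apply: eq_integral => y _; rewrite patch_strip patchE xD.
by apply: integral0_eq => y _; rewrite patch_strip patchE (negbTE xD).
Qed.

Lemma integral_strip2 (F : T1 * T2 -> \bar R) : measurable_fun DT F ->
  (forall z, 0 <= F z) ->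
  \int[m1 \x m2]_(z in DT) F z = \int[m2]_y \int[m1]_(x in D) F (x, y).
Proof.
move=> mF F0; rewrite integral_mkcond fubini_tonelli2//; last 2 first.
- exact: measurable_fun_strip.
- by move=> z; rewrite patchE; case: ifPn.
apply: eq_integral => y _; rewrite [RHS]integral_mkcond /fubini_G.
by apply: eq_integral => x _; rewrite patch_strip.
Qed.

End rectangle.

(** * From L2 to L1 on a set of finite measure *)

Section L2_L1.
Local Open Scope ereal_scope.
Context d (T : measurableType d) (R : realType) (mu : {measure set T -> \bar R}).
Variable D : set T.
Hypothesis mD : measurable D.
Hypothesis Dfin : mu D < +oo.

(** Integrates |f| <= e + f^2 / e, a consequence of (|f| - e)^2 >= 0. The free parameter replaces
    Cauchy-Schwarz: [e = 1] gives integrability, small [e] gives convergence. *)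
Lemma integral_norm_le_sqr (e : R) (f : T -> R) : (0 < e)%R ->
  measurable_fun D f ->
  \int[mu]_(x in D) `|f x|%:E <=
  e%:E * mu D + e^-1%:E * \int[mu]_(x in D) (f x ^+ 2)%:E.
Proof.
move=> e0 mf.
have mf2 : measurable_fun D (EFin \o (fun x => f x ^+ 2)%R).
  by apply/measurable_EFinP; exact: measurable_funX.
have ei0 : (0 <= e^-1)%R by rewrite invr_ge0 ltW.
rewrite -integral_cst// -ge0_integralZl_EFin//; last first.
  by move=> x _; rewrite lee_fin sqr_ge0.
have mg : measurable_fun D (fun x => e^-1%:E * (f x ^+ 2)%:E).
  by apply: emeasurable_funM.
have g0 x : D x -> 0 <= e^-1%:E * (f x ^+ 2)%:E.
  by move=> _; rewrite mule_ge0// lee_fin// sqr_ge0.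
rewrite -ge0_integralD//; last by move=> x _; rewrite lee_fin ltW.
apply: ge0_le_integral => //.
- by apply/measurable_EFinP; exact: measurableT_comp.
- exact: emeasurable_funD.
- move=> x _; rewrite /cst -EFinM -EFinD lee_fin.
  have := sqr_ge0 (`|f x| - e)%R; rewrite sqrrB real_normK ?num_real// => H.
  have H' : (`|f x| * (2 * e) <= e ^+ 2 + f x ^+ 2)%R.
    by move: H; set n := `|f x|%R; rewrite -mulr_natl; lra.
  have : (`|f x| <= (e ^+ 2 + f x ^+ 2) / e)%R.
    rewrite ler_pdivlMr//; apply: le_trans H'.
    by rewrite ler_wpM2l// ler_peMl ?ltW// ltr1n.
  by rewrite mulrDl expr2 mulfK ?gt_eqF// [(f x * _ / e)%R]mulrC.
Qed.

Lemma L2_integrable (f : T -> R) : measurable_fun D f ->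
  \int[mu]_(x in D) (f x ^+ 2)%:E < +oo -> mu.-integrable D (EFin \o f).
Proof.
move=> mf f2; apply/integrableP; split; first exact/measurable_EFinP.
apply: (le_lt_trans (@integral_norm_le_sqr 1 f ltr01 mf)).
by rewrite lte_add_pinfty// lte_mul_pinfty// lee_fin invr_ge0.
Qed.

Lemma L2_cvg_L1 (f_ : nat -> T -> R) : (forall n, measurable_fun D (f_ n)) ->
  (fun n => \int[mu]_(x in D) (f_ n x ^+ 2)%:E) @ \oo --> 0 ->
  (fun n => \int[mu]_(x in D) `|f_ n x|%:E) @ \oo --> 0.
Proof.
move=> mf_ /ge0_cvge0P H.
have {}H e : (0 < e)%R -> \forall n \near \oo, \int[mu]_(x in D) (f_ n x ^+ 2)%:E <= e%:E.
  by apply: H => n; apply: integral_ge0 => x _; rewrite lee_fin sqr_ge0.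
apply/ge0_cvge0P; first by move=> n; exact: integral_ge0.
move=> e e0.
have Dfn : mu D \is a fin_num by rewrite ge0_fin_numE.
pose M := (fine (mu D) + 1)%R.
have M0 : (0 < M)%R by rewrite ltr_wpDl// fine_ge0.
(* Gives e' mu(D) <= e / 2, while squares integrating to at most (e / 2) e' contribute the other
   half; [M] exceeds mu(D) by 1 so as to be positive. *)
pose e' := (e / 2 / M)%R.
have e'0 : (0 < e')%R by rewrite !divr_gt0.
near=> n.
apply: (le_trans (integral_norm_le_sqr e'0 (mf_ n))).
rewrite -(fineK Dfn).
apply: (@le_trans _ _ ((e' * fine (mu D))%:E + e'^-1%:E * (e / 2 * e')%:E)).
  rewrite EFinM leeD2l// lee_wpmul2l ?lee_fin ?invr_ge0 ?(ltW e'0)//.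
  by near: n; apply: H; rewrite mulr_gt0// divr_gt0.
rewrite -EFinM -EFinD lee_fin mulrCA mulVf ?gt_eqF// mulr1.
rewrite [leRHS]splitr lerD2r /e' -mulrA ler_piMr ?divr_ge0 ?ltW//.
rewrite mulrC ltr_pdivrMr// mul1r /M ltrDl//.
Unshelve. all: end_near. Qed.

End L2_L1.

Lemma Rintegral_sum_ord d (T : measurableType d) (R : realType)
    (mu : {measure set T -> \bar R}) (D : set T) (n : nat) (f : nat -> T -> R) :
  measurable D -> (forall j, (j < n)%N -> mu.-integrable D (EFin \o f j)) ->
  mu.-integrable D (EFin \o (fun x => \sum_(j < n) f j x)) /\
  \int[mu]_(x in D) (\sum_(j < n) f j x) =
    \sum_(j < n) \int[mu]_(x in D) f j x.
Proof.
move=> mD; elim: n => [_|n IH fi].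
  split.
    apply: (eq_integrable mD _ _ _ (integrable0 mu D)) => x _ /=.
    by rewrite big_ord0.
  under eq_Rintegral do rewrite big_ord0.
  by rewrite big_ord0 Rintegral_cst// mul0r.
have [i1 e1] : _ /\ _ := IH (fun j jn => fi j (leqW jn)).
have i2 := fi n (ltnSn n).
split.
  apply: (eq_integrable mD _ _ _ (integrableD mD i1 i2)) => x _ /=.
  by rewrite big_ord_recr.
under eq_Rintegral do rewrite big_ord_recr/=.
by rewrite RintegralD// e1 big_ord_recr.
Qed.

Lemma coord_xivec (R : realType) d (O : measurableType d) (xi : nat -> O -> R)
  n w j : (j < n)%N -> Defs.coord (xivec xi n w) j = xi j w.
Proof.
elim: n => // n IH; rewrite ltnS leq_eqVlt => /orP[/eqP ->|jn] /=.
  by rewrite eqxx.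
by rewrite ltn_eqF// IH.
Qed.

Lemma validj_nterms M N j : (j < nterms M N)%N -> validj M j.
Proof. by case: M => //= m; rewrite leq_min => /andP[]. Qed.

Lemma validN_nterms M N : validN M (nterms M N).
Proof. by case: M => //= m; exact: geq_minr. Qed.

(** Only an inequality, because [fine] sends both infinities to 0. It bounds [mean_a] and [int_a]
    even where the underlying integral is not finite. *)
Lemma abse_fine_le (R : realDomainType) (x : \bar R) : (`|fine x|%:E <= `|x|)%E.
Proof. by case: x => [r| |] //=; rewrite normr0 leey. Qed.

(** * The truncated integrals and their L1 limit *)

Section KL_estimates.
Context (R : realType) d (O : measurableType d) (P : probability O R).
Notation leb := (@lebesgue_measure R).
Variables (t0 T : R) (a : R -> O -> R).
Variables (M : option nat) (nu : nat -> R) (phi : nat -> R -> R).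
Variable xi : nat -> O -> R.
Hypothesis HKL : is_KL P t0 T a M nu phi xi.
Hypothesis Ha : L2_process P t0 T a.

Notation I := `[t0, T]%classic.
Notation IO := (I `*` [set: O]).
Notation KLN := (KL_sum P a M nu phi xi).

Let mI : measurable (I : set (measurableTypeR R)). Proof. exact: measurable_itv. Qed.

Let I_fin : (leb I < +oo)%E.
Proof. by rewrite lebesgue_measure_itv/=; case: ifP => _; rewrite ?ltry. Qed.

Let mIO : measurable IO. Proof. exact: measurableX. Qed.

Let IO_fin : ((leb \x P)%E IO < +oo)%E.
Proof.
rewrite product_measure1E// lte_mul_pinfty//.
  by rewrite ge0_fin_numE.
by rewrite (le_lt_trans (probability_le1 P measurableT))// ltry.
Qed.

Let ma : measurable_fun IO (fun z : R * O => a z.1 z.2).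
Proof. by case: Ha. Qed.

Let maE : measurable_fun IO (fun z : R * O => (`|a z.1 z.2|)%:E).
Proof. by apply/measurable_EFinP; exact: measurableT_comp. Qed.

Let a_L1 : (\int[(leb \x P)%E]_(z in IO) `|a z.1 z.2|%:E < +oo)%E.
Proof.
case: Ha => _ _ a2.
by have /integrableP[_] := @L2_integrable _ _ _ (leb \x P)%E _ mIO IO_fin _ ma a2.
Qed.

Lemma integrable_mean_a : leb.-integrable I (EFin \o mean_a P a).
Proof.
have mE : measurable_fun I (fun s => \int[P]_w (a s w)%:E)%E.
  apply: (@measurable_fun_strip_integral2 _ _ _ _ _ P _ mI (fun z => (a z.1 z.2)%:E)).
  exact/measurable_EFinP.
have mm : measurable_fun I (mean_a P a).
  rewrite [mean_a P a](_ : _ = fine \o (fun s => \int[P]_w (a s w)%:E)%E).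
    exact: measurableT_comp.
  by apply/funext => s; rewrite /mean_a unlock.
apply/integrableP; split; first exact/measurable_EFinP.
apply: le_lt_trans a_L1.
rewrite (@integral_strip1 _ _ _ _ _ leb P _ mI)//.
apply: ge0_le_integral => //.
- by apply: measurableT_comp => //; exact/measurable_EFinP.
- exact: (@measurable_fun_strip_integral2 _ _ _ _ _ P _ mI (fun z => `|a z.1 z.2|%:E)).
- move=> s sI; rewrite /= /mean_a unlock.
  apply: (le_trans (abse_fine_le _)); apply: le_abse_integral => //.
  case: Ha => mas _ _; apply/measurable_EFinP; apply: mas.
  by rewrite inE in sI *.
Qed.

(** A real-valued integral reads an infinite value as 0, so the normalisation to 1 forces the square
    of [phi j] to have a finite integral; the interval being bounded, [phi j] is integrable. *)
Lemma integrable_phi j : validj M j -> leb.-integrable I (EFin \o phi j).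
Proof.
move=> vj; have := KL_phi_orthonormal HKL vj vj.
rewrite eqxx /Rintegral => E.
apply: L2_integrable => //; first exact: (KL_phi_meas HKL).
rewrite ltey; apply/eqP => E'; move: E.
under eq_integral do rewrite -expr2.
by rewrite E'/= => /eqP; rewrite eq_sym oner_eq0.
Qed.

Lemma integrable_KL_terms n (y : nat -> R) : (forall j, (j < n)%N -> validj M j) ->
  forall j, (j < n)%N ->
  leb.-integrable I (EFin \o (fun s => Num.sqrt (nu j) * phi j s * y j)).
Proof.
move=> vn j jn.
have := integrableZl mI (Num.sqrt (nu j) * y j) (integrable_phi (vn j jn)).
apply: eq_integrable => // s _ /=.
by rewrite -EFinM mulrAC.
Qed.

Lemma integrable_KL_sum N w : leb.-integrable I (EFin \o (KLN N ^~ w)).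
Proof.
have [isum _] := Rintegral_sum_ord mI
  (integrable_KL_terms (fun j => xi j w) (@validj_nterms M N)).
by apply: (eq_integrable mI _ _ _ (integrableD mI integrable_mean_a isum)) => s _.
Qed.

Lemma measurable_KL_sum N : measurable_fun IO (fun z : R * O => KLN N z.1 z.2).
Proof.
apply: measurable_funD.
  apply: (measurable_fun_strip_fst mI).
  by apply/measurable_EFinP; exact: measurable_int integrable_mean_a.
(* The bound on [n] stays in the induction, since [phi] and [xi] are known to be measurable at valid
   indices only. *)
suff H n : (n <= nterms M N)%N -> measurable_fun IO
    (fun z : R * O => \sum_(j < n) Num.sqrt (nu j) * phi j z.1 * xi j z.2).
  exact: H.
elim: n => [_|n IH nN].
  rewrite [X in measurable_fun _ X](_ : _ = cst 0); first exact: measurable_cst.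
  by apply/funext => z; rewrite big_ord0.
have vn : validj M n by exact: validj_nterms nN.
rewrite [X in measurable_fun _ X](_ : _ = (fun z : R * O =>
    \sum_(j < n) Num.sqrt (nu j) * phi j z.1 * xi j z.2 +
    Num.sqrt (nu n) * phi n z.1 * xi n z.2)); last first.
  by apply/funext => z; rewrite big_ord_recr.
apply: measurable_funD; first exact: IH (ltnW nN).
apply: measurable_funM.
  apply: measurable_funM => //.
  by apply: (measurable_fun_strip_fst mI); exact: (KL_phi_meas HKL).
apply: measurable_funTS; apply: measurableT_comp => //.
exact: (KL_xi_meas HKL).
Qed.

Variable t : R.
Hypothesis tI : t \in `[t0, T].
Notation J := `[t0, t]%classic.

Let mJ : measurable (J : set (measurableTypeR R)). Proof. exact: measurable_itv. Qed.

Let JI : J `<=` I.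
Proof.
move: tI; rewrite in_itv/= => /andP[_ tT] s /=; rewrite !in_itv/= => /andP[-> st].
exact: le_trans st tT.
Qed.

Let integrableJ f : leb.-integrable I f -> leb.-integrable J f.
Proof. by apply: integrableS. Qed.

Definition KL_const : R := \int[leb]_(s in J) mean_a P a s.
Definition KL_coef (j : nat) : R :=
  Num.sqrt (nu j) * \int[leb]_(s in J) phi j s.

Lemma K_aE n (y : ms_type (Rspace R n)) : (forall j, (j < n)%N -> validj M j) ->
  K_a P t0 a nu phi t y = affine_form KL_const KL_coef y.
Proof.
move=> vn; rewrite /K_a /affine_form.
have [isum esum] := Rintegral_sum_ord mJ (fun j jn => integrableJ
  (integrable_KL_terms (Defs.coord y) vn jn)).
rewrite RintegralD//; last exact: integrableJ integrable_mean_a.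
rewrite esum; congr (_ + _); apply: eq_bigr => j _.
under eq_Rintegral do rewrite mulrAC.
rewrite RintegralZl//; last exact: integrableJ (integrable_phi (vn j (ltn_ord j))).
by rewrite /KL_coef mulrAC.
Qed.

Lemma K_a_xivec N w : K_a P t0 a nu phi t (xivec xi (nterms M N) w) =
  \int[leb]_(s in J) KLN N s w.
Proof.
apply: eq_Rintegral => s _; rewrite /KL_sum; congr (_ + _).
by apply: eq_bigr => j _; rewrite coord_xivec.
Qed.

Definition int_a (w : O) : R := \int[leb]_(s in J) a s w.

Let maJ : measurable_fun (J `*` [set: O]) (fun z : R * O => (a z.1 z.2)%:E).
Proof.
apply/measurable_EFinP; apply: measurable_funS ma => //.
by move=> [s w] /= [/JI].
Qed.

Lemma measurable_int_a : measurable_fun setT int_a.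
Proof.
rewrite [int_a](_ : _ = fine \o (fun w => \int[leb]_(s in J) (a s w)%:E)%E)//.
apply: measurableT_comp => //.
exact: (@measurable_fun_strip_integral1 _ _ _ _ _ leb _ mJ (fun z => (a z.1 z.2)%:E)).
Qed.

Lemma integral_norm_int_a : (\int[P]_w `|int_a w|%:E < +oo)%E.
Proof.
apply: le_lt_trans a_L1; rewrite (@integral_strip2 _ _ _ _ _ leb P _ mI)//.
apply: ge0_le_integral => //.
- apply/measurable_EFinP; apply: measurableT_comp => //; exact: measurable_int_a.
- exact: (@measurable_fun_strip_integral1 _ _ _ _ _ leb _ mI (fun z => `|a z.1 z.2|%:E)).
move=> w _ /=; apply: (le_trans (abse_fine_le _)).
have maw := measurable_fun_strip_section mJ w maJ.
apply: (le_trans (le_abse_integral leb mJ maw)).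
apply: ge0_subset_integral => //.
exact: (measurable_fun_strip_section mI w maE).
Qed.

(* If a(., w) - KL_N(., w) is not integrable the bound is trivial; otherwise
   a(., w) is integrable because KL_N(., w) is. *)
Lemma dist_K_a_int_a N w :
  (`|K_a P t0 a nu phi t (xivec xi (nterms M N) w) - int_a w|%:E <=
   \int[leb]_(s in I) `|a s w - KLN N s w|%:E)%E.
Proof.
rewrite K_a_xivec.
have iK := integrableJ (integrable_KL_sum N w).
have mdI : measurable_fun I (fun s => a s w - KLN N s w).
  apply/measurable_EFinP.
  apply: (@measurable_fun_strip_section _ _ _ _ _ _ mI
    (fun z => (a z.1 z.2 - KLN N z.1 z.2)%:E) w).
  by apply/measurable_EFinP/measurable_funB => //; exact: measurable_KL_sum.
apply: (@le_trans _ _ (\int[leb]_(s in J) `|a s w - KLN N s w|%:E)%E); last first.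
  apply: ge0_subset_integral => //.
  by apply/measurable_EFinP; exact: measurableT_comp.
have mdJ : measurable_fun J (fun s => a s w - KLN N s w).
  exact: measurable_funS mdI.
have [doo|] := ltP (\int[leb]_(s in J) `|a s w - KLN N s w|%:E)%E +oo%E; last first.
  by rewrite leye_eq => /eqP ->; exact: leey.
have id : leb.-integrable J (EFin \o (fun s => a s w - KLN N s w)).
  by apply/integrableP; split => //; exact/measurable_EFinP.
have ia : leb.-integrable J (EFin \o (a ^~ w)).
  apply: (eq_integrable mJ _ _ _ (integrableD mJ id iK)) => s _ /=.
  by rewrite -EFinD subrK.
rewrite distrC /int_a -RintegralB// EFin_normr_Rintegral//.
exact: (le_abse_integral leb mJ (measurable_int _ id)).
Qed.

Hypothesis mxi : forall N, measurable_fun setT (xivec xi (nterms M N)).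

Lemma measurable_K_a N : measurable_fun setT
  (fun w => K_a P t0 a nu phi t (xivec xi (nterms M N) w)).
Proof.
under eq_fun do rewrite (K_aE _ (@validj_nterms M N)).
by apply: measurableT_comp; [exact: measurable_affine_form|exact: mxi].
Qed.

(** The pathwise bound, integrated over the sample space, is by Tonelli the L1 distance on the
    strip, which the L2 convergence of the expansion sends to 0. *)
Lemma cvg_K_a :
  (fun N => \int[P]_w `|K_a P t0 a nu phi t (xivec xi (nterms M N) w) - int_a w|%:E)%E
    @ \oo --> 0%E.
Proof.
have mdiff N : measurable_fun IO (fun z : R * O => a z.1 z.2 - KLN N z.1 z.2).
  by apply: measurable_funB => //; exact: measurable_KL_sum.
have mdE N : measurable_fun IO (fun z : R * O => `|a z.1 z.2 - KLN N z.1 z.2|%:E).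
  by apply/measurable_EFinP; exact: measurableT_comp.
have L1 := @L2_cvg_L1 _ _ _ (leb \x P)%E _ mIO IO_fin
  (fun N (z : R * O) => a z.1 z.2 - KLN N z.1 z.2) mdiff (KL_cvg HKL).
apply: squeeze_cvge L1; last exact: cvg_cst.
near=> N; rewrite integral_ge0//=.
rewrite (@integral_strip2 _ _ _ _ _ leb P _ mI _ (mdE N))//.
apply: ge0_le_integral => //.
- apply/measurable_EFinP; apply: measurableT_comp => //; apply: measurable_funB.
    exact: measurable_K_a.
  exact: measurable_int_a.
- exact: (@measurable_fun_strip_integral1 _ _ _ _ _ leb _ mI
    (fun z => `|a z.1 z.2 - KLN N z.1 z.2|%:E) (mdE N)).
by move=> w _; exact: dist_K_a_int_a.
Unshelve. all: end_near. Qed.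

End KL_estimates.

(** * The limit density *)

Section support.
Context (R : realType) d (O : measurableType d) (P : probability O R).
Notation leb := (@lebesgue_measure R).
Variables (x0 : O -> R) (f0 : R -> R).
Hypothesis Hf0 : is_density leb P x0 f0.

(** The point 0 is excluded because the bound C / |x| says nothing there; what remains is invariant
    under positive scaling. *)
Definition supp : set R := [set x | x != 0 /\ Dx0 P x0 x].

Lemma Dx0P : [\/ P [set w | x0 w <= 0] = 0%E /\ Dx0 P x0 = `]0, +oo[%classic,
  P [set w | 0 <= x0 w] = 0%E /\ Dx0 P x0 = `]-oo, 0[%classic |
  Dx0 P x0 = setT].
Proof.
rewrite /Dx0; case: asboolP => [p|_]; first by apply: Or31.
by case: asboolP => [p|_]; [apply: Or32|apply: Or33].
Qed.

Lemma open_Dx0 : open (Dx0 P x0).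
Proof. by case: Dx0P => [[_ ->]|[_ ->]|->]; [exact: interval_open..|exact: openT]. Qed.

Lemma supp_scale x k : supp (x * expR k) <-> supp x.
Proof.
rewrite /supp/= mulf_eq0 (gt_eqF (expR_gt0 k)) orbF.
case: Dx0P => [[_ ->]|[_ ->]|->] //=; rewrite !in_itv/= ?andbT.
  by rewrite pmulr_lgt0// expR_gt0.
by rewrite pmulr_llt0// expR_gt0.
Qed.

Lemma suppP : [\/ P [set w | x0 w <= 0] = 0%E /\ supp = `]0, +oo[%classic,
  P [set w | 0 <= x0 w] = 0%E /\ supp = `]-oo, 0[%classic |
  supp = ~` [set 0]].
Proof.
case: Dx0P => [[p E]|[p E]|E].
- apply: Or31; split => //; rewrite /supp E; apply/seteqP; split => x /=.
    by case.
  by move=> xp; split => //; move: xp; rewrite in_itv/= andbT => /gt_eqF ->.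
- apply: Or32; split => //; rewrite /supp E; apply/seteqP; split => x /=.
    by case.
  by move=> xp; split => //; move: xp; rewrite in_itv/= => /lt_eqF ->.
- by apply: Or33; rewrite /supp E; apply/seteqP; split => x /=; [case=> /eqP|move/eqP].
Qed.

Lemma measurable_supp : measurable supp.
Proof.
rewrite [supp](_ : _ = ~` [set 0] `&` Dx0 P x0).
  apply: measurableI; first exact: measurableC.
  exact: open_measurable open_Dx0.
by apply/seteqP; split => x [/eqP].
Qed.

(** In the one-sided cases this is the definition of [Dx0]; in the remaining case only 0 is left
    out, and a law with a density has no atom. *)
Lemma probability_not_supp : P (x0 @^-1` (~` supp)) = 0%E.
Proof.
have [mx0 mf0 f00 x0E] := Hf0.
have P0 : P (x0 @^-1` [set 0]) = 0%E by rewrite x0E// integral_set1.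
have sub0 A B : measurable A -> measurable B -> A `<=` B -> P B = 0%E -> P A = 0%E.
  by move=> mA mB AB B0; apply: (subset_measure0 mA mB AB B0).
have mS : measurable (x0 @^-1` (~` supp)).
  by apply: measurable_preimageT => //; exact: (measurableC measurable_supp).
have mle : measurable [set w | x0 w <= 0].
  rewrite [X in measurable X](_ : _ = x0 @^-1` `]-oo, 0]).
    exact: measurable_preimageT.
  by apply/seteqP; split => w /=; rewrite in_itv.
have mge : measurable [set w | 0 <= x0 w].
  rewrite [X in measurable X](_ : _ = x0 @^-1` `[0, +oo[).
    exact: measurable_preimageT.
  by apply/seteqP; split => w /=; rewrite in_itv/= andbT.
case: suppP => [[p E]|[p E]|E].
- apply: (sub0 _ _ mS mle _ p) => w /=; rewrite E/= in_itv/= andbT => /negP.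
  by rewrite -leNgt.
- apply: (sub0 _ _ mS mge _ p) => w /=; rewrite E/= in_itv/= => /negP.
  by rewrite -leNgt.
- by rewrite E setCK.
Qed.

Lemma integral_not_supp A : measurable A -> A `<=` ~` supp ->
  (\int[leb]_(x in A) (f0 x)%:E = 0)%E.
Proof.
have [mx0 mf0 f00 x0E] := Hf0.
move=> mA AS; rewrite -x0E//.
apply: subset_measure0 probability_not_supp.
- exact: measurable_preimageT.
- by apply: measurable_preimageT => //; exact: (measurableC measurable_supp).
- by move=> w /AS.
Qed.

Lemma not_supp_null : leb [set u | ~ supp u /\ f0 u != 0] = 0%E.
Proof.
have [mx0 mf0 f00 x0E] := Hf0.
have mS : measurable (~` supp) by exact: (measurableC measurable_supp).
have mfS : measurable_fun (~` supp) (EFin \o f0).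
  by apply/measurable_EFinP; exact: measurable_funTS.
have : (\int[leb]_(x in ~` supp) `|(f0 x)%:E| = 0)%E.
  rewrite -[RHS](integral_not_supp mS (@subset_refl _ _)).
  by apply: eq_integral => x _; rewrite gee0_abs// lee_fin.
move=> /(ae_eq_integral_abs leb mS mfS)[N [mN N0 sub]].
have mZ : measurable [set u | ~ supp u /\ f0 u != 0].
  rewrite [X in measurable X](_ : _ = ~` supp `&` f0 @^-1` (~` [set 0])).
    apply: measurableI => //; apply: measurable_preimageT => //.
    exact: measurableC.
  by apply/seteqP; split => u /= [? /eqP].
apply: (@subset_measure0 _ _ _ leb _ _ mZ mN _ N0) => u [/= Su fu].
apply: sub => /= /(_ Su).
by case=> /eqP; rewrite (negbTE fu).
Qed.

(** A nonzero value at [y] puts x e^-k, with k the value of the form at [y], in the null set where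
    [f0] is nonzero off the support. That set stays null when pulled back through the exponential,
    the reflection of the line and the form. *)
Lemma scaled_density_not_supp n b c x :
  (exists2 j, (j < n)%N & c j != 0) -> x != 0 -> ~ supp x ->
  ms_meas (Rspace R n)
    [set y | scaled_density f0 x (affine_form b c y) != 0] = 0%E.
Proof.
move=> cj x0' Sx.
have [mx0 mf0 f00 x0E] := Hf0.
pose Z := [set u | ~ supp u /\ f0 u != 0].
pose W := (fun k => -1 * k + 0) @^-1` ((fun k => x * expR k) @^-1` Z).
have mZ : measurable Z.
  rewrite [X in measurable X](_ : _ = ~` supp `&` f0 @^-1` (~` [set 0])).
    apply: measurableI; first exact: (measurableC measurable_supp).
    by rewrite -[X in measurable X]setTI; apply: mf0 => //; exact: measurableC.
  by apply/seteqP; split => u /= [? /eqP].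
have mZ' : measurable ((fun k => x * expR k) @^-1` Z).
  rewrite -[X in measurable X]setTI.
  by apply: (measurable_funM (@measurable_cst _ _ _ _ _ _) (@measurable_expR _)).
have mW : measurable W.
  have mneg : measurable_fun setT (fun k : R => -1 * k + 0).
    by apply: measurable_funD => //; exact: measurable_funM.
  by rewrite -[W]setTI; exact: mneg.
have W0 : leb W = 0%E.
  have n1 : (-1 : R) != 0 by rewrite oppr_eq0 oner_eq0.
  apply: (lebesgue_null_affine 0 n1 mZ').
  by apply: lebesgue_null_expR => //; exact: not_supp_null.
have mL := @measurable_affine_form R n b c.
apply: (subset_measure0 _ _ _ (affine_form_null b cj mW W0)).
- have ms : measurable_fun setT (fun y => scaled_density f0 x (@affine_form R n b c y)).
    exact: (measurable_scaled_density mf0 (@measurable_cst _ _ _ _ _ _)).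
  rewrite [X in measurable X](_ : _ = setT `&`
      (fun y => scaled_density f0 x (@affine_form R n b c y)) @^-1` (~` [set 0])).
    by apply: ms => //; exact: measurableC.
  by rewrite setTI; apply/seteqP; split => y /= /eqP.
- by rewrite -[X in measurable X]setTI; exact: mL.
- move=> y /=; rewrite /scaled_density mulf_eq0 negb_or => /andP[fy _].
  rewrite /W/= addr0 mulN1r; split => //.
  by move=> /(supp_scale x).
Qed.

End support.

(** * Continuity and boundedness of h_x on the support *)

Section regular.
Context (R : realType) d (O : measurableType d) (P : probability O R).
Variables (x0 : O -> R) (f0 : R -> R).
Hypothesis f00 : forall y, 0 <= f0 y.
Hypothesis f0c : {within Dx0 P x0, continuous f0}.
Variable C : R.
Hypothesis f0b : forall x, x != 0 -> Dx0 P x0 x -> f0 x <= C / `|x|.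

(** The point x e^-k never leaves the open set [Dx0], on which continuity within the subspace is
    ordinary continuity. *)
Lemma scaled_density_continuous x : supp P x0 x -> continuous (scaled_density f0 x).
Proof.
move=> Sx k.
have cexp : expR (- k') @[k' --> k] --> expR (- k).
  apply: (@continuous_comp _ _ _ (fun k : R => - k) expR).
    exact: opp_continuous.
  exact: continuous_expR.
apply: cvgM => //.
have [_ Dk] : supp P x0 (x * expR (- k)) by exact/supp_scale.
have f0k : {for x * expR (- k), continuous f0}.
  move: f0c; rewrite continuous_open_subspace; last exact: open_Dx0.
  by apply; rewrite inE.
have cx : x * expR (- k') @[k' --> k] --> x * expR (- k).
  by apply: cvgM => //; exact: cvg_cst.
exact: (cvg_comp _ _ cx f0k).
Qed.

(** The factor e^-k cancels against the one in C / |x e^-k|, so the bound is uniform in [k]. *)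
Lemma scaled_density_bounded x k : supp P x0 x ->
  0 <= scaled_density f0 x k <= C / `|x|.
Proof.
move=> Sx; rewrite scaled_density_ge0//=.
have [xk0 Dk] : supp P x0 (x * expR (- k)) by exact/supp_scale.
have := f0b xk0 Dk; rewrite normrM (gtr0_norm (expR_gt0 _)) => H.
rewrite /scaled_density (le_trans (ler_wpM2r (expR_ge0 _) H))//.
by rewrite invfM mulrA mulfVK// gt_eqF// expR_gt0.
Qed.

End regular.

(** * Convergence of f_1^N and identification of the limit *)

Section limit.
Context (R : realType) d (O : measurableType d) (P : probability O R).
Notation leb := (@lebesgue_measure R).
Variables (t0 T : R) (x0 : O -> R) (a : R -> O -> R).
Variables (M : option nat) (nu : nat -> R) (phi : nat -> R -> R).
Variables (xi : nat -> O -> R) (f0 : R -> R).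
Variable fxi : forall n, ms_type (Rspace R n) -> R.
Arguments fxi : clear implicits.
Hypothesis HKL : is_KL P t0 T a M nu phi xi.
Hypothesis H1 : L2_process P t0 T a.
Hypothesis H2 : forall N, validN M N ->
  is_density (ms_meas (Rspace R N)) P (xivec xi N) (fxi N) /\
  indep2 P x0 (xivec xi N).
Hypothesis Hf0 : is_density leb P x0 f0.
Hypothesis H3cont : {within Dx0 P x0, continuous f0}.
Variable C : R.
Hypothesis H3bound : forall x, x != 0 -> Dx0 P x0 x -> f0 x <= C / `|x|.

Let mx0 : measurable_fun setT x0. Proof. by case: Hf0. Qed.
Let mf0 : measurable_fun setT f0. Proof. by case: Hf0. Qed.
Let f00 y : 0 <= f0 y. Proof. by case: Hf0. Qed.

Let mxi N : measurable_fun setT (xivec xi (nterms M N)).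
Proof. by have [[]] := H2 (validN_nterms M N). Qed.

(** Every K_a(t, .) is then constant, with the same value for all truncations; t = t0 is an
    instance. *)
Definition degenerate (t : R) : Prop :=
  forall j, validj M j -> KL_coef t0 nu phi t j = 0.

(* Off the support f0 is only known to vanish almost everywhere. There f_1^N is
   eventually 0 as soon as one coefficient of the affine form K_a(t, .) is
   nonzero; otherwise K_a(t, .) is constant and so is f_1^N. *)
Definition limit_density (x t : R) : R :=
  \1_(supp P x0) x * fine (\int[P]_w (scaled_density f0 x (int_a t0 a t w))%:E)%E +
  \1_(~` supp P x0) x *
    (if `[< degenerate t >] then scaled_density f0 x (KL_const P t0 a t) else 0).

Section fixed_time.
Variable t : R.
Hypothesis tI : t \in `[t0, T].
Notation K := (int_a t0 a t).
Notation Kn N w := (K_a P t0 a nu phi t (xivec xi (nterms M N) w)).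

Let mK : measurable_fun setT K. Proof. exact: (measurable_int_a H1 tI). Qed.

Let mKn N : measurable_fun setT (fun w => Kn N w).
Proof. exact: (measurable_K_a HKL H1 tI mxi). Qed.

Let f1NE x N : f1N P t0 a M nu phi f0 fxi x t N =
  (\int[P]_w (scaled_density f0 x (Kn N w))%:E)%E.
Proof.
have vn := @validj_nterms M N.
have [[_ mfx fx0 fxE] _] := H2 (validN_nterms M N).
set n := nterms M N in vn mfx fx0 fxE *.
pose g (y : ms_type (Rspace R n)) : \bar R :=
  (scaled_density f0 x (K_a P t0 a nu phi t y))%:E.
have mg : measurable_fun setT g.
  apply/measurable_EFinP; apply: measurable_scaled_density => //.
  rewrite [X in measurable_fun _ X](_ : _ =
      affine_form (KL_const P t0 a t) (KL_coef t0 nu phi t)).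
    exact: measurable_affine_form.
  by apply/funext => y; exact: (K_aE HKL H1 tI).
rewrite -[RHS]/(\int[P]_w g (xivec xi n w))%E.
rewrite (@ge0_integral_density _ _ _ _ _ P (ms_meas (Rspace R n)) (xivec xi n)
  setT (fxi n))//.
- by apply: eq_integral => y _; rewrite -EFinM /scaled_density mulrAC.
- exact: mxi.
- by move=> B mB; rewrite setTI; exact: (fxE B mB).
- by move=> y; rewrite lee_fin scaled_density_ge0.
Qed.

Let supp_fin x : supp P x0 x ->
  (\int[P]_w (scaled_density f0 x (K w))%:E)%E \is a fin_num.
Proof.
move=> Sx; apply: integrable_fin_num => //.
apply: (@bounded_integrable_comp _ _ _ _ setT (C / `|x|) (scaled_density f0 x)) => //.
  exact: (continuous_measurable_fun (scaled_density_continuous H3cont Sx)).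
by move=> k; exact: (scaled_density_bounded f00 H3bound k Sx).
Qed.

Lemma f1N_cvg_supp x : supp P x0 x ->
  f1N P t0 a M nu phi f0 fxi x t N @[N --> \oo] --> (limit_density x t)%:E.
Proof.
move=> Sx; under eq_fun do rewrite f1NE.
rewrite /limit_density !indicE mem_set// memNset; last exact.
rewrite mul1r mul0r addr0 fineK; last exact: supp_fin.
apply: (@cvg_integral_comp _ _ _ P setT (C / `|x|)) => //.
- exact: (scaled_density_continuous H3cont Sx).
- by move=> k; exact: (scaled_density_bounded f00 H3bound k Sx).
- exact: (integral_norm_int_a H1 tI).
- exact: (cvg_K_a HKL H1 tI mxi).
Qed.

Lemma f1N_cvg_not_supp x : x != 0 -> ~ supp P x0 x ->
  f1N P t0 a M nu phi f0 fxi x t N @[N --> \oo] --> (limit_density x t)%:E.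
Proof.
move=> xn0 Sx.
rewrite /limit_density !indicE memNset// mem_set// mul1r mul0r add0r.
case: asboolP => [deg|ndeg].
  apply: cvg_near_cst; near=> N.
  rewrite f1NE; under eq_integral => w _.
    rewrite (K_aE HKL H1 tI _ (@validj_nterms M N)) /affine_form big1 ?addr0; last first.
      by move=> j _; rewrite deg ?mul0r//; exact: validj_nterms (ltn_ord j).
    over.
  rewrite [LHS](integral_cst P measurableT) -[RHS]mule1.
  by congr (_ * _)%E; exact: probability_setT.
have [j vj cj] : exists2 j, validj M j & KL_coef t0 nu phi t j != 0.
  apply: contrapT => H; apply: ndeg => j vj; apply/eqP/negPn/negP => cj.
  by apply: H; exists j.
apply: cvg_near_cst; near=> N.
(* For a finite expansion a valid [j] is below the cap as well, so every [N] beyond [j] includes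
   this coefficient. *)
have jN : (j < nterms M N)%N.
  have : (j < N)%N by near: N; exact: nbhs_infty_gt.
  by move: vj; rewrite /nterms /validj; case: (M) => // m; rewrite leq_min => -> ->.
have cjN : exists2 j, (j < nterms M N)%N & KL_coef t0 nu phi t j != 0 by exists j.
have null := @scaled_density_not_supp _ _ _ P x0 f0 Hf0 (nterms M N)
  (KL_const P t0 a t) (KL_coef t0 nu phi t) x cjN xn0 Sx.
have [[_ mfx fx0 _] _] := H2 (validN_nterms M N).
have vn := @validj_nterms M N.
rewrite /f1N; set n := nterms M N in null vn mfx fx0 *.
pose g (y : ms_type (Rspace R n)) := scaled_density f0 x
  (affine_form (KL_const P t0 a t) (KL_coef t0 nu phi t) y).
have mg : measurable_fun setT g.
  by apply: measurable_scaled_density => //; exact: measurable_affine_form.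
transitivity (\int[ms_meas (Rspace R n)]_y (g y * fxi n y)%:E)%E.
  by apply: eq_integral => y _; rewrite (K_aE HKL H1 tI)// mulrAC.
rewrite (ge0_negligible_integral _ _ _ _ null)//.
- apply: integral0_eq => y [_ /= /negP]; rewrite negbK -/(g y) => /eqP ->.
  by rewrite mul0r.
- rewrite [X in measurable X](_ : _ = setT `&` g @^-1` (~` [set 0])).
    by apply: mg => //; exact: measurableC.
  by rewrite setTI; apply/seteqP; split => y /= /eqP.
- by apply/measurable_EFinP; exact: measurable_funM.
- by move=> y _; rewrite lee_fin mulr_ge0// scaled_density_ge0.
Unshelve. all: end_near. Qed.

Let x0K : indep2 P x0 K.
Proof.
apply: (@indep2_cvg _ _ _ P x0 (fun N w => Kn N w)) => //.
- exact: (integral_norm_int_a H1 tI).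
- exact: (cvg_K_a HKL H1 tI mxi).
- move=> N A B mA mB; have [_ ind] := H2 (validN_nterms M N).
  have vn := @validj_nterms M N.
  (* As a measurable function of the random vector, K_N inherits its independence from [x0]. *)
  have E : (fun w => Kn N w) @^-1` B = xivec xi (nterms M N) @^-1`
      (affine_form (KL_const P t0 a t) (KL_coef t0 nu phi t) @^-1` B).
    by apply/seteqP; split => w /=; rewrite (K_aE HKL H1 tI).
  rewrite E; apply: ind => //.
  by rewrite -[X in measurable X]setTI; exact: measurable_affine_form.
Qed.

Lemma limit_density_ge0 x : 0 <= limit_density x t.
Proof.
rewrite addr_ge0// mulr_ge0//.
  by apply/fine_ge0/integral_ge0 => w _; rewrite lee_fin scaled_density_ge0.
by case: ifP => // _; exact: scaled_density_ge0.
Qed.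

Lemma measurable_limit_density : measurable_fun setT (limit_density ^~ t).
Proof.
have mS := measurable_supp P x0.
apply: measurable_funD; apply: measurable_funM.
- exact: measurable_indic.
- apply: measurableT_comp => //.
  apply: (@measurable_fun_integral2 _ _ _ _ _ P
    (fun z : R * O => (scaled_density f0 z.1 (K z.2))%:E)).
  apply/measurable_EFinP; apply: measurable_scaled_density => //.
  exact: measurableT_comp.
- by apply: measurable_indic; exact: measurableC.
- case: `[< degenerate t >] => //.
  exact: measurable_scaled_density.
Qed.

Lemma limit_density_is_density :
  is_density leb P (xsol t0 x0 a t) (limit_density ^~ t).
Proof.
have mS := measurable_supp P x0.
have mX : measurable_fun setT (xsol t0 x0 a t).
  by apply: measurable_funM => //; exact: measurableT_comp.
have ml := measurable_limit_density.
split => //; first exact: limit_density_ge0.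
move=> A mA.
have mAS : measurable (A `&` supp P x0) by exact: measurableI.
have mAD : measurable (A `\` supp P x0) by exact: measurableD.
have AE : A = (A `&` supp P x0) `|` (A `\` supp P x0) by rewrite setUIDK.
rewrite {2}AE ge0_integral_setU//; last 3 first.
- by apply/measurable_EFinP; exact: measurable_funTS.
- by move=> x _; rewrite lee_fin limit_density_ge0.
- by apply/disj_setPS => x [[_ ?] [_ ?]].
(* The values prescribed off the support carry no mass: in the degenerate case undoing the scaling
   gives an integral of [f0] over a set still disjoint from the support. *)
have -> : (\int[leb]_(x in A `\` supp P x0) (limit_density x t)%:E = 0)%E.
  case: (asboolP (degenerate t)) => [deg|ndeg]; last first.
    apply: integral0_eq => x [_ Sx]; rewrite /limit_density indicE memNset//.
    by rewrite asboolF// mulr0 mul0r addr0.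
  transitivity (\int[leb]_(x in A `\` supp P x0)
      (f0 (x / expR (KL_const P t0 a t)) / expR (KL_const P t0 a t))%:E)%E.
    apply: eq_integral => x /set_mem[_ Sx]; rewrite /limit_density !indicE.
    by rewrite memNset// mem_set// asboolT// mul0r add0r mul1r /scaled_density expRN.
  rewrite -ge0_integral_scale//; last exact: expR_gt0.
  apply: (integral_not_supp Hf0).
    have ms : measurable_fun setT (fun u : R => u * expR (KL_const P t0 a t)).
      exact: measurable_funM.
    by rewrite -[X in measurable X]setTI; exact: ms.
  by move=> u [_ /= Su] /(supp_scale P x0 u (KL_const P t0 a t)).
rewrite adde0.
(* The solution lies off the support only if [x0] does, an event of probability 0. *)
transitivity (P (xsol t0 x0 a t @^-1` (A `&` supp P x0))).
  rewrite {1}AE preimage_setU measureU.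
  - rewrite [X in (_ + X)%E](_ : _ = 0%E) ?adde0//.
    apply: subset_measure0 (probability_not_supp Hf0).
    + exact: measurable_preimageT.
    + by apply: measurable_preimageT => //; exact: measurableC.
    + by move=> w [_ /= Sw] x0w; apply: Sw; exact/supp_scale.
  - exact: measurable_preimageT.
  - exact: measurable_preimageT.
  - by apply/seteqP; split => // w [[_ ?] [_ ?]].
rewrite [LHS](probability_mul_expR Hf0 mK x0K mAS).
apply: eq_integral => x /set_mem[_ Sx].
rewrite /limit_density !indicE mem_set// memNset; last exact.
by rewrite mul1r mul0r addr0 fineK//; exact: supp_fin.
Qed.

End fixed_time.
End limit.

Unset Implicit Arguments.

Theorem theorem8 (R : realType) (d : measure_display) (O : measurableType d)
    (P : probability O R) (HPcomplete : measure_is_complete P)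
    (t0 T : R) (ht0T : t0 < T)
    (x0 : O -> R) (a : R -> O -> R)
    (M : option nat) (nu : nat -> R) (phi : nat -> R -> R) (xi : nat -> O -> R)
    (HKL : is_KL P t0 T a M nu phi xi)
    (f0 : R -> R) (fxi : forall n, ms_type (Rspace R n) -> R)
    (H1 : L2_process P t0 T a)
    (H2 : forall N, validN M N ->
       is_density (ms_meas (Rspace R N)) P (xivec xi N) (fxi N) /\
       indep2 P x0 (xivec xi N))
    (Hf0 : is_density (@lebesgue_measure R) P x0 f0)
    (H3cont : {within Dx0 P x0, continuous f0})
    (H3bound : exists C : R, forall x, x != 0 -> Dx0 P x0 x -> f0 x <= C / `|x|) :
  exists f1 : R -> R -> R,
    (forall t, t \in `[t0, T] ->
       is_density (@lebesgue_measure R) P (xsol t0 x0 a t) (fun x => f1 x t)) /\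
    (forall x t, x != 0 -> t \in `[t0, T] ->
       f1N P t0 a M nu phi f0 fxi x t N @[N --> \oo] --> (f1 x t)%:E).
Proof.
have [C f0C] := H3bound.
exists (limit_density P t0 x0 a M nu phi f0); split.
  by move=> t tI; exact: (limit_density_is_density HKL H1 H2 Hf0 H3cont f0C tI).
move=> x t xn0 tI; have [Sx|Sx] := pselect (supp P x0 x).
  exact: (f1N_cvg_supp HKL H1 H2 Hf0 H3cont f0C tI Sx).
exact: (f1N_cvg_not_supp HKL H1 H2 Hf0 tI xn0 Sx).
Qed.
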